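(* Let $\eta \in \mathbb{Z}[\mathbb{X}]^W$, and write $\eta = \sum_{\mu \in \mathbb{X}^+} c_{\mu}\, s(\mu)$ with $c_\mu\in\mathbb{Z}$ (almost all zero). (1) Suppose that for every $\lambda \in \mathbb{X}^+$ the product $\chi(\lambda)\,\eta$ is a good filtration character. Then for all $\mu,\mu'\in\mathbb{X}^+$ with $\mu \le \mu'$ one has $c_{\mu} \ge c_{\mu'}$. (2) Suppose that for every $\lambda \in \mathbb{X}^+$ the product $\chi((p-1)\rho+p\lambda)\,\eta$ is a good filtration character. Then for all $\mu,\mu'\in\mathbb{X}^+$ with $(\mu-\rho) \uparrow (\mu'-\rho)$ one has $c_{\mu} \ge c_{\mu'}$.
   Context: Let $p$ be a prime and let $G$ be a simple, simply connected algebraic group over an algebraically closed field of characteristic $p$, with maximal torus $T$, irreducible root system $\Phi$, positive roots $\Phi^+$, simple roots $\alpha_1,\dots,\alpha_n$, and coroots $\alpha^\vee$. $\mathbb{X}$ is the character group (weight lattice) of $T$, $\langle\cdot,\cdot\rangle$ the pairing of weights with coroots, $\mathbb{X}^+$ the dominant weights, $\rho$ the half-sum of the positive roots, $W$ the Weyl group. The order $\le$ on $\mathbb{X}$: $\mu\le\lambda$ iff $\lambda-\mu$ is a $\mathbb{Z}_{\ge 0}$-combination of simple roots. $\mathbb{Z}[\mathbb{X}]$ is the group ring with basis $e(\mu)$, $\mu\in\mathbb{X}$; $\mathbb{Z}[\mathbb{X}]^W$ is the subring of $W$-invariants. For $\mu\in\mathbb{X}$, $s(\mu)=\sum_{\nu\in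 W\mu}e(\nu)$ is the orbit sum; the $s(\mu)$, $\mu\in\mathbb{X}^+$, form a $\mathbb{Z}$-basis of $\mathbb{Z}[\mathbb{X}]^W$. For $\lambda\in\mathbb{X}^+$, $\chi(\lambda)$ is the Weyl character of highest weight $\lambda$; the $\chi(\lambda)$, $\lambda \in \mathbb{X}^+$, also form a $\mathbb{Z}$-basis of $\mathbb{Z}[\mathbb{X}]^W$. A good filtration character is a nonzero element of $\mathbb{Z}[\mathbb{X}]^W$ whose coefficients in the basis of Weyl characters are all nonnegative. For $\alpha\in\Phi^+$ and $n\in\mathbb{Z}$ put $s_{\alpha,np}\bullet\lambda=\lambda-(\langle\lambda+\rho,\alpha^\vee\rangle-np)\alpha$ (the dot action of an affine reflection). The relation $\lambda\uparrow\mu$ on $\mathbb{X}$ means that $\lambda=\mu$ or there are such affine reflections $s_1,\dots,s_m$ with $\lambda\le s_1\bullet\lambda\le s_2\bullet s_1\bullet\lambda\le\cdots\le s_m\bullet\cdots\bullet s_1\bullet\lambda=\mu$. *)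

(* Defs.v *)
From HB Require Import structures.
From mathcomp Require Import all_boot all_order all_algebra finmap.
From mathcomp Require Import boolp classical_sets functions cardinality fsbigop.
From mathcomp.multinomials Require Import monalg.

Set Implicit Arguments.
Unset Strict Implicit.
Unset Printing Implicit Defensive.

Import Order.TTheory GRing.Theory Num.Theory.
Local Open Scope classical_set_scope.
Local Open Scope ring_scope.

(* The group ring Z[X] of an additive group X. The ring structure that
   multinomials puts on [{malg int[K]}] needs a [monomType] K, i.e. a monoid
   without nontrivial units, so the convolution product is set up here on an
   alias. *)
Section GroupRing.
Variable X : zmodType.

Definition group_ring := {malg int[X]}.
HB.instance Definition _ := GRing.Zmodule.on group_ring.

Definition ebasis (x : X) : group_ring := << x >>.

Implicit Types (f g h : group_ring) (x y : X).

Definition gr_mul f g : group_ring :=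
  \sum_(x <- msupp f) \sum_(y <- msupp g) << f@_x * g@_y *g x + y >>.

Lemma gr_mulwl f g (d : {fset X}) : (msupp f `<=` d)%fset ->
  gr_mul f g =
  \sum_(x <- d) \sum_(y <- msupp g) << f@_x * g@_y *g x + y >> :> group_ring.
Proof.
move=> le_d; rewrite /gr_mul (big_fset_incl _ le_d) // => x _ xf.
by rewrite big1 // => y _; rewrite mcoeff_outdom // mul0r monalgU0.
Qed.

Lemma gr_mulw f g (d1 d2 : {fset X}) :
  (msupp f `<=` d1)%fset -> (msupp g `<=` d2)%fset ->
  gr_mul f g =
  \sum_(x <- d1) \sum_(y <- d2) << f@_x * g@_y *g x + y >> :> group_ring.
Proof.
move=> le1 le2; rewrite (gr_mulwl _ le1); apply: eq_bigr => x _.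
rewrite (big_fset_incl _ le2) // => y _ yg.
by rewrite [g@_y]mcoeff_outdom // mulr0 monalgU0.
Qed.

Lemma gr_mulC : commutative gr_mul.
Proof.
move=> f g; rewrite /gr_mul exchange_big /=; apply: eq_bigr => y _.
by apply: eq_bigr => x _; rewrite mulrC addrC.
Qed.

Lemma gr_mulDl : left_distributive gr_mul +%R.
Proof.
move=> f g h; set d := (msupp f `|` msupp g)%fset.
rewrite (@gr_mulwl f h d) ?fsubsetUl // (@gr_mulwl g h d) ?fsubsetUr //.
rewrite (@gr_mulwl (f + g) h d) ?msuppD_le // -big_split /=.
apply: eq_bigr => x _; rewrite -big_split /=; apply: eq_bigr => y _.
by rewrite mcoeffD mulrDl monalgUD.
Qed.

Lemma gr_mulUU x y (a b : int) :
  gr_mul << a *g x >> << b *g y >> = << a * b *g x + y >>.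
Proof.
rewrite (@gr_mulw _ _ [fset x]%fset [fset y]%fset) ?msuppU_le //.
by rewrite !big_seq_fset1 !mcoeffUU.
Qed.

Lemma gr_mulDr : right_distributive gr_mul +%R.
Proof. by move=> f g h; rewrite !(gr_mulC f) gr_mulDl. Qed.

Lemma gr_mul0l : left_zero 0 gr_mul.
Proof. by move=> f; rewrite /gr_mul msupp0 big_seq_fset0. Qed.

Lemma gr_mul0r : right_zero 0 gr_mul.
Proof. by move=> f; rewrite gr_mulC gr_mul0l. Qed.

Lemma gr_mul_suml I (r : seq I) (F : I -> group_ring) g :
  gr_mul (\sum_(i <- r) F i) g = \sum_(i <- r) gr_mul (F i) g.
Proof.
elim: r => [|i r IH]; first by rewrite !big_nil gr_mul0l.
by rewrite !big_cons gr_mulDl IH.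
Qed.

Lemma gr_mul_sumr I (r : seq I) (F : I -> group_ring) g :
  gr_mul g (\sum_(i <- r) F i) = \sum_(i <- r) gr_mul g (F i).
Proof.
by rewrite gr_mulC gr_mul_suml; apply: eq_bigr => i _; rewrite gr_mulC.
Qed.

Lemma gr_mulA : associative gr_mul.
Proof.
move=> f g h; rewrite [f]monalgE (gr_mul_suml _ _ g) !gr_mul_suml.
apply: eq_bigr => x _; rewrite [g]monalgE (gr_mul_suml _ _ h).
rewrite !(gr_mul_sumr _ _ << _ *g x >>) gr_mul_suml; apply: eq_bigr => y _.
rewrite [h]monalgE (gr_mul_sumr _ _ << _ *g y >>) !gr_mul_sumr.
apply: eq_bigr => z _.
by rewrite !gr_mulUU mulrA addrA.
Qed.

Lemma gr_mul1 : left_id (ebasis 0) gr_mul.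
Proof.
move=> f; rewrite [in LHS](monalgE f) gr_mul_sumr [RHS]monalgE; apply: eq_bigr => x _.
by rewrite gr_mulUU mul1r add0r.
Qed.

Lemma gr_oner_neq0 : ebasis 0 != 0.
Proof. by apply/eqP/malgP => /(_ 0); rewrite mcoeffUU mcoeff0. Qed.

HB.instance Definition _ := GRing.Zmodule_isComNzRing.Build group_ring
  gr_mulA gr_mulC gr_mul1 gr_mulDl gr_oner_neq0.

End GroupRing.

(* A reduced root datum (X, Phi, Y, Phi^vee) together with a base of Phi.
   The character lattice X is identified with row vectors and the cocharacter
   lattice Y with column vectors, both over int, in such a way that the perfect
   pairing X x Y -> Z is the matrix product. The base is indexed by 'I_n with
   n the rank of X, so only semisimple data are covered. *)
Definition pairing n (l : 'rV[int]_n) (y : 'cV[int]_n) : int := (l *m y) 0 0.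

Record based_root_datum (n : nat) := BasedRootDatum {
  root_set : {fset 'rV[int]_n};
  coroot : 'rV[int]_n -> 'cV[int]_n;
  base : 'I_n -> 'rV[int]_n;
  pairing_coroot : forall a, a \in root_set -> pairing a (coroot a) = 2;
  reflect_root : forall a b, a \in root_set -> b \in root_set ->
    b - pairing b (coroot a) *: a \in root_set;
  coroot_inj : {in root_set &, injective coroot};
  reflect_coroot : forall a b, a \in root_set -> b \in root_set ->
    exists2 c, c \in root_set & coroot c = coroot b - pairing a (coroot b) *: coroot a;
  root_reduced : forall a b (k l : int), a \in root_set -> b \in root_set ->
    k != 0 -> k *: a = l *: b -> b = a \/ b = - a;
  base_root : forall i, base i \in root_set;
  base_free : forall k : 'I_n -> int,
    \sum_i k i *: base i = 0 -> forall i, k i = 0;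
  base_span : forall a, a \in root_set -> exists k : 'I_n -> nat,
    a = \sum_i base i *+ k i \/ a = - \sum_i base i *+ k i
}.

Section RootDatum.
Variables (n : nat) (D : based_root_datum n).

Local Notation X := 'rV[int]_n.
Local Notation ZX := (group_ring X).
Implicit Types (l m a : X) (f : ZX).

Definition simply_connected := forall y : 'cV[int]_n,
  exists k : X -> int, y = \sum_(a <- root_set D) k a *: coroot D a.

Definition irreducible_root_system :=
  root_set D != fset0 /\
  forall A B : {fset X}, root_set D = (A `|` B)%fset ->
    (forall a b, a \in A -> b \in B -> pairing a (coroot D b) = 0) ->
    A = fset0 \/ B = fset0.

Definition dominance_le l m := exists k : 'I_n -> nat,
  m - l = \sum_i base D i *+ k i.

Definition positive_root a := a \in root_set D /\ dominance_le 0 a.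

(* 2 rho has even coordinates when the datum is simply connected, so that the
   coordinatewise Euclidean division by 2 is then exact. *)
Definition rho : X :=
  map_mx (fun z : int => (z %/ 2)%Z) (\sum_(a <- root_set D | `[< positive_root a >]) a).

Definition dominant : set X :=
  [set l | forall i, 0 <= pairing l (coroot D (base D i))].

(* Elements of the Weyl group act on X by right multiplication; the first
   matrix below is that of l |-> l - <l, a^vee> a. *)
Definition reflection_mx a : 'M[int]_n := 1%:M - coroot D a *m a.

Inductive weyl : set 'M[int]_n :=
| weyl_one : weyl 1%:M
| weyl_reflection a w : a \in root_set D -> weyl w -> weyl (reflection_mx a *m w).

Definition weyl_orbit m : set X := [set m *m w | w in weyl].

Definition weyl_act (w : 'M[int]_n) f : ZX :=
  \sum_(m <- msupp f) ebasis (m *m w) *~ f@_m.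

Definition weyl_invariant f := forall w, weyl w -> weyl_act w f = f.

Definition orbit_sum m : ZX := \sum_(v \in weyl_orbit m) ebasis v.

Definition alternating_sum l : ZX :=
  \sum_(w \in weyl) ebasis (l *m w) *~ \det w.

(* Weyl's character formula: the quotient of two alternating sums, in the
   domain ZX. *)
Definition weyl_character l : ZX :=
  xget 0 [set f | alternating_sum rho * f = alternating_sum (l + rho)].

Definition good_filtration_character f :=
  [/\ f != 0, weyl_invariant f &
    exists b : X -> int,
      [/\ finite_set (dominant `&` [set l | b l != 0]),
          forall l, dominant l -> 0 <= b l &
          f = \sum_(l \in dominant) weyl_character l *~ b l]].

Definition affine_dot (p : nat) a (k : int) l : X :=
  l - (pairing (l + rho) (coroot D a) - k * p%:Z) *: a.

Inductive up_linked (p : nat) : X -> X -> Prop :=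
| up_refl l : up_linked p l l
| up_step l m a k : positive_root a ->
    dominance_le l (affine_dot p a k l) ->
    up_linked p (affine_dot p a k l) m -> up_linked p l m.

End RootDatum.

(* Main.v *)
Require Import Defs.
From mathcomp Require Import all_boot all_order all_algebra finmap.
From mathcomp Require Import boolp classical_sets functions cardinality fsbigop.
From mathcomp.multinomials Require Import monalg.
From mathcomp Require Import zify ring.

Import Order.TTheory GRing.Theory Num.Theory.
Local Open Scope classical_set_scope.
Local Open Scope ring_scope.

Set Implicit Arguments.
Unset Strict Implicit.
Unset Printing Implicit Defensive.

(** Write [A(x)] for the alternating sum of [x] over the Weyl group. Multiplying the
expansion of [chi(la) * eta] in Weyl characters by [A(rho)] turns it into an expansion of
[A(la + rho) * eta] in alternating sums of strictly dominant weights, and such a sum has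
coefficient 1 at its own weight and 0 at the other strictly dominant weights. So each
hypothesis says that [A(q th) * eta] has nonnegative coefficients at all strictly dominant
weights, for every strictly dominant [th], with [q = 1] in (1) and [q = p] in (2)
([good_filtration_coef_ge0]). The quotient defining [chi(la)] exists because
[chi(la) * eta] is not zero, and a Weyl character that failed to exist would contribute
zero on the right-hand side.

Let [th] have pairing [m] with one simple coroot [alpha_i^vee] and very large pairings with
the others. Every element of the Weyl group other than 1 and [s_i] moves [th] so far that
the finitely supported [eta] does not see it, and the coefficient at [nu + q th] is the
difference of the coefficients of [eta] at [nu] and at [nu + q m alpha_i]
([simple_translate_le]). By Weyl invariance this becomes: reflecting a weight in a
hyperplane [<x, b^vee> = l q] with [l >= 0], from the side of 0 to the far side, does not
increase its coefficient ([affine_reflection_le]).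

For (1), descend from [mu'] to [mu] by subtracting simple roots: as long as
[x - mu] is a nonzero nonnegative combination of simple roots, some simple root occurring in
it pairs positively with [x - mu], hence with [x], since [mu] is dominant. Only the
dominance of [mu] matters, so the intermediate weights need not be dominant
([descend_to_dominant]).

For (2), the affine reflections in a chain realizing the linkage relation go upwards,
that is, away from a point far inside the antidominant chamber, whereas the coefficients of
[eta] are known to decrease only under reflections away from 0. The two notions are
connected by moving a base point from 0 along a ray [- t gam] with [gam] generic
and strictly dominant. It crosses one hyperplane at a time. Suppose that [f] decreases under
reflections away from the base point before the crossing, and let [r] be the reflection in
the hyperplane crossed. Then [max (f x) (f (r x))] decreases under reflections
away from the base point after the crossing: [r] fixes the crossing point, hence
permutes the reflections away from it. A dominant [mu] lies on the side of 0 of every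
hyperplane crossed, so that [f (r mu) <= f mu] and the value at [mu] is unchanged
([oriented_step]). After enough crossings all steps of the given chain go away from the base
point, and comparing the ends of the chain gives (2) ([up_linked_dominant_le]). *)

(** * The pairing *)

Section Pairing.
Variable n : nat.
Implicit Types (x : 'rV[int]_n) (y : 'cV[int]_n) (c : int).

Lemma pairingDl x1 x2 y : pairing (x1 + x2) y = pairing x1 y + pairing x2 y.
Proof. by rewrite /pairing mulmxDl mxE. Qed.

Lemma pairingNl x y : pairing (- x) y = - pairing x y.
Proof. by rewrite /pairing mulNmx mxE. Qed.

Lemma pairingBl x1 x2 y : pairing (x1 - x2) y = pairing x1 y - pairing x2 y.
Proof. by rewrite pairingDl pairingNl. Qed.

Lemma pairingZl c x y : pairing (c *: x) y = c * pairing x y.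
Proof. by rewrite /pairing -scalemxAl mxE. Qed.

Lemma pairingMnl x y k : pairing (x *+ k) y = pairing x y *+ k.
Proof. by rewrite -scaler_nat pairingZl mulr_natl. Qed.

Lemma pairing0l y : pairing 0 y = 0.
Proof. by rewrite /pairing mul0mx mxE. Qed.

Lemma pairing_suml I (r : seq I) (P : pred I) (F : I -> 'rV[int]_n) y :
  pairing (\sum_(i <- r | P i) F i) y = \sum_(i <- r | P i) pairing (F i) y.
Proof.
elim/big_rec2: _ => [|i u v _ <-]; first exact: pairing0l.
by rewrite pairingDl.
Qed.

Lemma pairingBr x y1 y2 : pairing x (y1 - y2) = pairing x y1 - pairing x y2.
Proof. by rewrite /pairing mulmxBr !mxE. Qed.

Lemma pairingZr c x y : pairing x (c *: y) = c * pairing x y.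
Proof. by rewrite /pairing -scalemxAr mxE. Qed.

Lemma pairing0r x : pairing x 0 = 0.
Proof. by rewrite /pairing mulmx0 mxE. Qed.

Lemma pairingDr x y1 y2 : pairing x (y1 + y2) = pairing x y1 + pairing x y2.
Proof. by rewrite /pairing mulmxDr !mxE. Qed.

Lemma pairingNr x y : pairing x (- y) = - pairing x y.
Proof. by rewrite /pairing mulmxN mxE. Qed.

Lemma pairing_sumr I (r : seq I) (P : pred I) x (F : I -> 'cV[int]_n) :
  pairing x (\sum_(i <- r | P i) F i) = \sum_(i <- r | P i) pairing x (F i).
Proof.
elim/big_rec2: _ => [|i u v _ <-]; first exact: pairing0r.
by rewrite pairingDr.
Qed.

Lemma pairing_mulmx x (w : 'M[int]_n) y : pairing (x *m w) y = pairing x (w *m y).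
Proof. by rewrite /pairing mulmxA. Qed.

Lemma pairing_delta x j : pairing x (delta_mx j 0) = x 0 j.
Proof. by rewrite /pairing -colE mxE. Qed.

Lemma delta_pairing y j : pairing (delta_mx 0 j) y = y j 0.
Proof. by rewrite /pairing -rowE mxE. Qed.

Lemma pairing_injr y1 y2 : (forall x, pairing x y1 = pairing x y2) -> y1 = y2.
Proof.
by move=> eqy; apply/colP => j; rewrite -!delta_pairing eqy.
Qed.

End Pairing.

(** * Root systems and words in the simple reflections *)

Section RootSystem.
Variables (n : nat) (D : based_root_datum n).
Local Notation X := 'rV[int]_n.
Local Notation Phi := (root_set D).
Local Notation cr := (coroot D).
Local Notation al := (base D).
Local Notation refl := (reflection_mx D).
Local Notation pos := (positive_root D).
Implicit Types (x y : X) (a b : X).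

Lemma mul_reflection x a : x *m refl a = x - pairing x (cr a) *: a.
Proof.
rewrite /reflection_mx mulmxBr mulmx1 mulmxA; congr (_ - _).
by rewrite [x *m _]mx11_scalar mul_scalar_mx.
Qed.

Lemma reflection_mul a (y : 'cV[int]_n) : refl a *m y = y - pairing a y *: cr a.
Proof.
rewrite /reflection_mx mulmxBl mul1mx -mulmxA; congr (_ - _).
by rewrite [a *m _]mx11_scalar mul_mx_scalar.
Qed.

Lemma reflectionK a : a \in Phi -> refl a *m refl a = 1%:M.
Proof.
move=> aP; apply/row_matrixP => i; rewrite !rowE mulmxA mulmx1.
rewrite mul_reflection mul_reflection pairingBl pairingZl pairing_coroot //.
by rewrite mulrDr mulr1 opprD addrA subrr sub0r scaleNr opprK subrK.
Qed.

Lemma root_reflection a b : a \in Phi -> b \in Phi -> b *m refl a \in Phi.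
Proof. by move=> aP bP; rewrite mul_reflection; apply: reflect_root. Qed.

Lemma mul_reflection_self a : a \in Phi -> a *m refl a = - a.
Proof.
move=> aP; rewrite mul_reflection pairing_coroot //.
by rewrite scaler_nat mulr2n opprD addrA subrr sub0r.
Qed.

Lemma opp_root a : a \in Phi -> - a \in Phi.
Proof. by move=> aP; rewrite -mul_reflection_self // root_reflection. Qed.

Lemma root_neq0 a : a \in Phi -> a != 0.
Proof.
by move=> /pairing_coroot; apply: contra_eq_neq => ->; rewrite pairing0l.
Qed.

(** A Weyl-invariant form; it gives access to signs, because its value at a root differs from
the pairing with the coroot by a positive factor. *)
Definition root_form x y := \sum_(a <- Phi) pairing x (cr a) * pairing y (cr a).
Local Notation form := root_form.

Lemma rformC x y : form x y = form y x.
Proof. by apply: eq_bigr => a _; rewrite mulrC. Qed.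

Lemma rformDl x1 x2 y : form (x1 + x2) y = form x1 y + form x2 y.
Proof.
by rewrite /form -big_split; apply: eq_bigr => a _; rewrite pairingDl mulrDl.
Qed.

Lemma rformZl c x y : form (c *: x) y = c * form x y.
Proof.
by rewrite /form mulr_sumr; apply: eq_bigr => a _; rewrite pairingZl mulrA.
Qed.

Lemma rformNl x y : form (- x) y = - form x y.
Proof. by rewrite -scaleN1r rformZl mulN1r. Qed.

Lemma rformBl x1 x2 y : form (x1 - x2) y = form x1 y - form x2 y.
Proof. by rewrite rformDl rformNl. Qed.

Lemma rform0l y : form 0 y = 0.
Proof. by rewrite -(scale0r 0) rformZl mul0r. Qed.

Lemma rform_suml I (r : seq I) (P : pred I) (F : I -> X) y :
  form (\sum_(i <- r | P i) F i) y = \sum_(i <- r | P i) form (F i) y.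
Proof.
elim/big_rec2: _ => [|i u v _ <-]; first exact: rform0l.
by rewrite rformDl.
Qed.

Lemma rformMnl x y k : form (x *+ k) y = form x y *+ k.
Proof. by rewrite -scaler_nat rformZl mulr_natl. Qed.

Lemma rformBr x y1 y2 : form x (y1 - y2) = form x y1 - form x y2.
Proof. by rewrite rformC rformBl !(rformC x). Qed.

Lemma rformZr c x y : form x (c *: y) = c * form x y.
Proof. by rewrite rformC rformZl rformC. Qed.

Lemma rformNr x y : form x (- y) = - form x y.
Proof. by rewrite rformC rformNl rformC. Qed.

Lemma rform_ge0 x : 0 <= form x x.
Proof. by apply: sumr_ge0 => a _; rewrite -expr2 sqr_ge0. Qed.

(** A reflection permutes the coroots over which the form is summed. *)
Lemma rform_reflection a x y : a \in Phi -> form (x *m refl a) (y *m refl a) = form x y.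
Proof.
move=> aP; pose L := [seq cr b | b <- Phi].
have LE z t : form z t = \sum_(c <- L) pairing z c * pairing t c.
  by rewrite big_map.
rewrite !LE; under eq_bigr do rewrite !pairing_mulmx.
rewrite -(big_map (mulmx (refl a)) xpredT (fun c => pairing x c * pairing y c)).
apply: perm_big.
have injr : injective (mulmx (refl a) : 'cV_n -> 'cV_n).
  by apply: (can_inj (g := mulmx (refl a))) => c; rewrite mulmxA reflectionK // mul1mx.
have uL : uniq L by rewrite map_inj_in_uniq ?fset_uniq //; apply: coroot_inj.
have uL' : uniq [seq refl a *m c | c <- L] by rewrite map_inj_uniq.
have sub : {subset [seq refl a *m c | c <- L] <= L}.
  move=> _ /mapP[_ /mapP[b bP ->] ->]; rewrite reflection_mul.
  by have [c cP <-] := reflect_coroot aP bP; apply: map_f.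
have [_ E] := uniq_min_size uL' sub (eq_leq (esym (size_map _ _))).
by apply: uniq_perm => // c; rewrite E.
Qed.

(** Invariance under the reflection in [a], which sends [a] to [- a]. *)
Lemma rform_root a x : a \in Phi -> form x a *+ 2 = pairing x (cr a) * form a a.
Proof.
move=> aP; have := rform_reflection x a aP.
rewrite mul_reflection_self // mul_reflection rformNr rformBl rformZl.
by lia.
Qed.

Lemma rform_root_gt0 a : a \in Phi -> 0 < form a a.
Proof.
move=> aP; have := rform_ge0 a; rewrite le_eqVlt => /orP[/eqP/esym|//].
move/eqP; rewrite psumr_eq0 => [/allP/(_ _ aP)|b _]; last by rewrite -expr2 sqr_ge0.
by rewrite pairing_coroot.
Qed.

Lemma rform_root_sg a x : a \in Phi ->
  ((0 < form x a) = (0 < pairing x (cr a))) *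
  ((0 <= form x a) = (0 <= pairing x (cr a))).
Proof.
move=> aP; have aa := rform_root_gt0 aP; have /eqP := rform_root x aP.
move=> /eqP E; split.
  by rewrite -(pmulr_lgt0 (pairing x _) aa) -E pmulrn_lgt0.
by rewrite -(pmulr_lge0 (pairing x _) aa) -E pmulrn_lge0.
Qed.

(** The data only say that the reflected coroot is the coroot of some root. The form
determines the coroot of a root, and this identifies that root. *)
Lemma coroot_reflection a b : a \in Phi -> b \in Phi ->
  cr (b *m refl a) = refl a *m cr b.
Proof.
move=> aP bP; apply: pairing_injr => x; rewrite -pairing_mulmx.
have bb := rform_root_gt0 bP.
have E : form (b *m refl a) (b *m refl a) = form b b by rewrite rform_reflection.
have := rform_root x (root_reflection aP bP); rewrite E.
have xE : x = x *m refl a *m refl a by rewrite -mulmxA reflectionK // mulmx1.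
rewrite {1}xE rform_reflection // rform_root // => /(mulIf (lt0r_neq0 bb)).
by move=> <-.
Qed.

Lemma corootN a : a \in Phi -> cr (- a) = - cr a.
Proof.
move=> aP; rewrite -mul_reflection_self // coroot_reflection // reflection_mul.
by rewrite pairing_coroot // scaler_nat mulr2n opprD addrA subrr sub0r.
Qed.

Definition word (s : seq 'I_n) : 'M[int]_n :=
  foldr (fun i w => refl (al i) *m w) 1%:M s.

Lemma word_cat s t : word (s ++ t) = word s *m word t.
Proof. by elim: s => [|i s IH] /=; rewrite ?mul1mx // IH mulmxA. Qed.

Lemma word_rev s : word (rev s) *m word s = 1%:M.
Proof.
elim: s => [|i s IH]; first by rewrite mulmx1.
rewrite rev_cons -cats1 word_cat /= mulmx1 -mulmxA (mulmxA (refl _)).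
by rewrite reflectionK ?base_root // mul1mx.
Qed.

Lemma word_revr s : word s *m word (rev s) = 1%:M.
Proof. by rewrite -{1}(revK s) word_rev. Qed.

Lemma root_word s a : a \in Phi -> a *m word s \in Phi.
Proof.
elim: s a => [|i s IH] a aP /=; first by rewrite mulmx1.
by rewrite mulmxA IH // root_reflection // base_root.
Qed.

Lemma coroot_word s a : a \in Phi -> cr (a *m word s) = word (rev s) *m cr a.
Proof.
elim: s a => [|i s IH] a aP /=; first by rewrite mulmx1 mul1mx.
have iP := base_root D i.
rewrite mulmxA IH ?root_reflection // coroot_reflection //.
by rewrite rev_cons -cats1 word_cat /= mulmx1 mulmxA.
Qed.

Lemma pairing_word s x a : a \in Phi ->
  pairing (x *m word s) (cr (a *m word s)) = pairing x (cr a).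
Proof.
by move=> aP; rewrite coroot_word // pairing_mulmx mulmxA word_revr mul1mx.
Qed.

Lemma reflection_word s a : a \in Phi ->
  refl (a *m word s) = word (rev s) *m refl a *m word s.
Proof.
move=> aP; rewrite /reflection_mx coroot_word // mulmxBr mulmx1 mulmxBl word_rev.
by rewrite !mulmxA.
Qed.

Lemma rform_word s x y : form (x *m word s) (y *m word s) = form x y.
Proof.
elim: s x y => [|i s IH] x y /=; first by rewrite !mulmx1.
by rewrite !mulmxA IH rform_reflection // base_root.
Qed.

Lemma base_sum_inj (k l : 'I_n -> int) :
  \sum_i k i *: al i = \sum_i l i *: al i -> k =1 l.
Proof.
move=> E i; apply/eqP; rewrite -subr_eq0; apply/eqP.
apply: (@base_free _ D (fun i => k i - l i)).
by under eq_bigr do rewrite scalerBl; rewrite sumrB E subrr.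
Qed.

Lemma posP a : pos a <-> a \in Phi /\ exists k : 'I_n -> nat, a = \sum_i (k i)%:Z *: al i.
Proof.
split=> -[aP [k E]]; split => //; exists k.
  by rewrite -[a]subr0 E; apply: eq_bigr => i _; rewrite -scaler_nat natz.
by rewrite subr0 E; apply: eq_bigr => i _; rewrite -scaler_nat natz.
Qed.

Lemma pos_root a : pos a -> a \in Phi. Proof. by case. Qed.

Lemma pos_dichotomy a : a \in Phi -> pos a \/ pos (- a).
Proof.
move=> aP; have [k [E|E]] := base_span aP; [left|right]; split; rewrite ?opp_root //.
  by exists k; rewrite subr0.
by exists k; rewrite subr0 E opprK.
Qed.

Lemma base_pos i : pos (al i).
Proof.
split; first exact: base_root; exists (fun j => (j == i) : nat); rewrite subr0.
rewrite (bigD1 i) //= eqxx mulr1n big1 ?addr0 // => j /negPf ->.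
by rewrite mulr0n.
Qed.

Lemma dominant_pos_ge0 x a : dominant D x -> pos a -> 0 <= pairing x (cr a).
Proof.
move=> xd /posP[aP [k aE]]; rewrite -rform_root_sg // aE rformC rform_suml.
apply: sumr_ge0 => i _; rewrite rformZl rformC mulr_ge0 //.
by rewrite rform_root_sg ?base_root.
Qed.

Lemma pos_of_pairing x a : dominant D x -> a \in Phi -> 0 < pairing x (cr a) -> pos a.
Proof.
move=> xd aP; have [//|aN] := pos_dichotomy aP.
by have := dominant_pos_ge0 xd aN; rewrite corootN // pairingNr; lia.
Qed.

Definition strictly_dominant x := forall i, 0 < pairing x (cr (al i)).

Lemma strictly_dominantW x : strictly_dominant x -> dominant D x.
Proof. by move=> xs i; apply: ltW. Qed.

Lemma strictly_dominant_pos_gt0 x a : strictly_dominant x -> pos a -> 0 < pairing x (cr a).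
Proof.
move=> xs apos; have xd := strictly_dominantW xs; have [aP [k aE]] := (posP a).1 apos.
rewrite lt_def dominant_pos_ge0 // andbT; apply: contraTneq (rform_root_gt0 aP) => xa0.
suff k0 i : k i = 0%N by rewrite {1}aE big1 ?rform0l ?ltxx // => i _; rewrite k0 scale0r.
have : form x a *+ 2 = 0 by rewrite rform_root // xa0 mul0r.
move/eqP; rewrite mulrn_eq0 /= aE rformC rform_suml.
rewrite psumr_eq0 => [/allP/(_ i (mem_index_enum _))|j _]; last first.
  by rewrite rformZl rformC mulr_ge0 // rform_root_sg ?base_root // ltW.
rewrite /= rformZl rformC mulf_eq0 [form _ _ == 0]gt_eqF ?orbF; first by move/eqP=> [].
by rewrite rform_root_sg ?base_root.
Qed.

(** A positive root other than [al i] involves some other simple root, whose coefficient is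
not changed by the reflection in [al i]. *)
Lemma pos_reflection i a : pos a -> a != al i -> pos (a *m refl (al i)).
Proof.
move=> /posP[aP [k aE]] aneq; have iP := base_root D i.
have [//|aN] := pos_dichotomy (root_reflection iP aP).
case/posP: aN => _ [l]; rewrite mul_reflection; set c := pairing _ _ => lE.
have kl : (fun j => (k j)%:Z - c * (j == i)%:R) =1 fun j => - (l j)%:Z.
  apply: base_sum_inj; under [RHS]eq_bigr do rewrite scaleNr.
  rewrite sumrN -lE opprK; under eq_bigr do rewrite scalerBl.
  rewrite sumrB -aE; congr (_ - _).
  rewrite (bigD1 i) //= eqxx mulr1 big1 ?addr0 // => j /negPf ->.
  by rewrite mulr0 scale0r.
have aE' : a = (k i)%:Z *: al i.
  rewrite aE (bigD1 i) //= big1 ?addr0 // => j ji.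
  have := kl j; rewrite (negPf ji) mulr0 subr0.
  by case: (k j) => [|m]; rewrite ?scale0r //; lia.
have E1 : 1 *: a = (k i)%:Z *: al i by rewrite scale1r.
have [E|E] := root_reduced aP iP (oner_neq0 _) E1; first by rewrite E eqxx in aneq.
by have := congr1 (fun x => pairing x (cr (al i))) aE'; rewrite -[a]opprK -E pairingNl
  pairingZl pairing_coroot //; lia.
Qed.

Lemma not_posN a : pos a -> ~ pos (- a).
Proof.
move=> /posP[aP [k aE]] /posP[_ [l lE]].
have kl : (fun j => (k j)%:Z) =1 fun j => - (l j)%:Z.
  apply: base_sum_inj; under [RHS]eq_bigr do rewrite scaleNr.
  by rewrite sumrN -lE opprK.
suff: a = 0 by move/eqP: (root_neq0 aP).
rewrite aE big1 // => i _.
have -> : (k i)%:Z = 0 by have /= := kl i; lia.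
exact: scale0r.
Qed.

(** The nonnegative combination of the numbers [form y (al i)] that equals [form y y] has a
positive term. *)
Lemma descent_direction (k : 'I_n -> nat) y : y = \sum_i (k i)%:Z *: al i ->
  0 < form y y -> exists i, (0 < k i)%N /\ 0 < pairing y (cr (al i)).
Proof.
move=> yE yy; apply: contrapT => none; suff : form y y <= 0 by rewrite leNgt yy.
rewrite {1}yE rform_suml; apply: sumr_le0 => i _; rewrite rformZl rformC.
case: (posnP (k i)) => [->|ki]; first by rewrite mul0r.
rewrite pmulr_rle0 // leNgt rform_root_sg ?base_root //; apply/negP => yi.
by apply: none; exists i.
Qed.

(** A positive root that is not simple pairs positively with some simple coroot, and the
corresponding reflection lowers its height while keeping it positive. *)
Lemma pos_root_conj a : pos a -> exists i s, a = al i *m word s.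
Proof.
move=> /posP[+ [k]]; have [m] := ubnP (\sum_i k i)%N.
elim: m a k => // m IH a k; rewrite ltnS => km aP aE.
have [ai|ne] := pselect (exists i, a = al i).
  by move: ai => [j ->]; exists j, [::]; rewrite /= mulmx1.
have [i [ki ai]] := descent_direction aE (rform_root_gt0 aP).
have ap : pos a by apply/posP; split=> //; exists k.
have ani : a != al i by apply/eqP => ai'; apply: ne; exists i.
have /posP[bP [l lE]] := pos_reflection ap ani.
set b := a *m _ in bP lE; set c := pairing a _ in ai.
have kl : (fun j => (l j)%:Z) =1 fun j => (k j)%:Z - c * (j == i)%:R.
  apply: base_sum_inj; rewrite -lE /b mul_reflection -/c [in LHS]aE.
  under [RHS]eq_bigr do rewrite scalerBl.
  rewrite sumrB; congr (_ - _); rewrite (bigD1 i) //= eqxx mulr1 big1 ?addr0 //.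
  by move=> j /negPf ->; rewrite mulr0 scale0r.
have lk : (\sum_i l i < \sum_i k i)%N.
  rewrite [X in (X < _)%N](bigD1 i) //= [X in (_ < X)%N](bigD1 i) //=.
  rewrite (eq_bigr k) ?ltn_add2r => [|j ji]; have := kl _.
    by move/(_ i); rewrite eqxx mulr1; lia.
  by move/(_ j); rewrite (negPf ji) mulr0 subr0 => -[].
have [j [s bE]] := IH b l (leq_trans lk km) bP lE.
exists j, (s ++ [:: i]); rewrite word_cat /= mulmx1 mulmxA -bE /b -mulmxA.
by rewrite reflectionK ?base_root // mulmx1.
Qed.

Lemma root_conj a : a \in Phi -> exists i s, a = al i *m word s.
Proof.
move=> aP; have [|/pos_root_conj[i [s E]]] := pos_dichotomy aP.
  exact: pos_root_conj.
exists i, (i :: s) => /=; rewrite mulmxA mul_reflection_self ?base_root //.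
by rewrite mulNmx -E opprK.
Qed.

(** The reflection in [al i *m w] is the conjugate by [w] of a simple reflection. *)
Lemma weyl_word w : weyl D w -> exists s, w = word s.
Proof.
elim=> [|a {}w aP _ [s ->]]; first by exists [::].
have [i [t ->]] := root_conj aP; exists (rev t ++ [:: i] ++ t ++ s).
by rewrite reflection_word ?base_root // !word_cat /= mulmx1 !mulmxA.
Qed.

Lemma word_weyl s : weyl D (word s).
Proof.
by elim: s => [|i s IH] /=; [left|right=> //; exact: base_root].
Qed.

(** The simple reflection at which a positive root first becomes negative can only be the one
in the root reached so far. *)
Lemma word_sends_to_simple s a : pos a -> ~ pos (a *m word s) ->
  exists s1 j s2, s = s1 ++ j :: s2 /\ a *m word s1 = al j.
Proof.
elim: s a => [|i s IH] a ap /=; first by rewrite mulmx1.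
have [->|ai] := eqVneq a (al i).
  by exists [::], i, s; rewrite /= mulmx1.
rewrite mulmxA => /(IH _ (pos_reflection ap ai))[s1 [j [s2 [-> E]]]].
by exists (i :: s1), j, s2; rewrite /= mulmxA.
Qed.

(** Deletion: the first simple root of the word must become negative further on, say at the
letter [j]; the two letters then cancel against each other, and the word can be
shortened. *)
Lemma word_pos_eq1 s : (forall i, pos (al i *m word s)) -> word s = 1%:M.
Proof.
have [m] := ubnP (size s); elim: m s => // m IH [//|i s]; rewrite ltnS /= => sm sp.
have iP := base_root D i.
have : ~ pos (al i *m word s).
  move=> /not_posN; apply; have := sp i.
  by rewrite mulmxA mul_reflection_self // mulNmx.
case/(word_sends_to_simple (base_pos i)) => s1 [j [s2 [sE ij]]].
have E : refl (al i) *m word s = word (s1 ++ s2).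
  rewrite sE !word_cat /= -ij reflection_word // !mulmxA.
  by rewrite -(mulmxA (refl _) (word s1)) word_revr mulmx1 reflectionK // mul1mx.
rewrite E; apply: IH => [|l]; last by rewrite -E.
by move: sm; rewrite sE !size_cat /=; lia.
Qed.

End RootSystem.

(** * Fundamental weights and the pairings of rho *)

Section Semisimple.
Variables (n : nat) (D : based_root_datum n).
Local Notation X := 'rV[int]_n.
Local Notation Phi := (root_set D).
Local Notation cr := (coroot D).
Local Notation al := (base D).
Local Notation refl := (reflection_mx D).
Local Notation pos := (positive_root D).
Local Notation form := (root_form D).
Local Notation word := (word D).
Implicit Types (x y : X) (a b : X).

(** Two triangular factorizations of the block matrix with rows [(1, cr a)] and [(a, 1)]. *)
Lemma det_reflection a : a \in Phi -> \det (refl a) = -1.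
Proof.
move=> aP; pose c := cr a.
have ac : a *m c = 2%:M by rewrite [LHS]mx11_scalar -/(pairing a c) pairing_coroot.
have E : block_mx 1%:M 0 a 1%:M *m block_mx 1%:M c 0 (1%:M - a *m c) =
  block_mx 1%:M c 0 1%:M *m block_mx (refl a) 0 a 1%:M.
  rewrite !mulmx_block !(mul1mx, mulmx1, mul0mx, mulmx0, addr0, add0r) -/c.
  by rewrite /reflection_mx subrK addrC subrK.
have := congr1 determinant E; rewrite !det_mulmx !det_lblock !det_ublock !det1.
rewrite !(mul1r, mulr1) => <-; rewrite ac.
by rewrite -raddfB det_scalar1.
Qed.

Hypothesis D_sc : simply_connected D.

Lemma coroots_separate x : (forall a, a \in Phi -> pairing x (cr a) = 0) -> x = 0.
Proof.
move=> x0; apply/rowP => j; rewrite mxE -pairing_delta.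
have [k ->] := D_sc (delta_mx j 0); rewrite pairing_sumr big1_seq // => a /andP[_ aP].
by rewrite pairingZr x0 // mulr0.
Qed.

Lemma rform_gt0 x : x != 0 -> 0 < form x x.
Proof.
move=> x0; rewrite lt_def rform_ge0 andbT; apply: contra_neq x0 => /eqP.
rewrite psumr_eq0 => [/allP xx|a _]; last by rewrite -expr2 sqr_ge0.
apply: coroots_separate => a aP; have := xx a aP.
by rewrite /= -expr2 sqrf_eq0 => /eqP.
Qed.

Let C : 'M[int]_n := \matrix_(r, j) cr (al j) r 0.

Lemma coroot_base_col i : cr (al i) = C *m delta_mx i 0.
Proof. by rewrite -colE; apply/colP => r; rewrite !mxE. Qed.

(** Every coroot is obtained from a simple one by simple reflections, which preserve the
integral span of the simple coroots. *)
Lemma simple_coroots_span (y : 'cV[int]_n) : exists k : 'cV[int]_n, y = C *m k.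
Proof.
have [k ->] := D_sc y; rewrite big_seq.
apply: (@big_ind _ (fun z : 'cV[int]_n => exists k : 'cV[int]_n, z = C *m k)).
- by exists 0; rewrite mulmx0.
- by move=> _ _ [u ->] [v ->]; exists (u + v); rewrite mulmxDr.
move=> a aP; have [i [s ->]] := root_conj aP; rewrite coroot_word ?base_root //.
suff [u ->] : exists u : 'cV[int]_n, word (rev s) *m cr (al i) = C *m u.
  by exists (k (al i *m word s) *: u); rewrite scalemxAr.
elim: (rev s) => [|j t [u IH]] /=; first by exists (delta_mx i 0); rewrite mul1mx coroot_base_col.
rewrite -mulmxA IH reflection_mul [cr (al j)]coroot_base_col.
set c := pairing _ _; exists (u - c *: delta_mx j 0).
by rewrite mulmxBr scalemxAr.
Qed.

(** The rows of the inverse of the matrix of simple coroots, which is invertible over the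
integers because its columns generate the cocharacter lattice. *)
Lemma fundamental_weights : exists fw : 'I_n -> X,
  (forall i j, pairing (fw i) (cr (al j)) = (i == j)%:R) /\
  (forall x, x = \sum_i pairing x (cr (al i)) *: fw i).
Proof.
have /choice[f fP] : forall r, exists k : 'cV[int]_n, delta_mx r 0 = C *m k.
  by move=> r; apply: simple_coroots_span.
pose K : 'M[int]_n := \matrix_(i, r) f r i 0.
have CK : C *m K = 1%:M.
  apply/matrixP => i r; have /colP/(_ i) := fP r; rewrite !mxE eqxx andbT => ->.
  by apply: eq_bigr => j _; rewrite !mxE.
have KC := mulmx1C CK; exists (fun i => row i K); split=> [i j|x].
  rewrite coroot_base_col /pairing rowE -!mulmxA (mulmxA K) KC mul1mx -rowE.
  by rewrite !mxE /= andbT.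
rewrite -[x in LHS]mulmx1 -CK mulmxA mulmx_sum_row; apply: eq_bigr => i _.
by rewrite coroot_base_col /pairing mulmxA -colE [in RHS]mxE.
Qed.

(** The reflection in [al i] permutes the positive roots other than [al i]. *)
Lemma double_rho_pairing i :
  pairing (\sum_(a <- Phi | `[< pos a >]) a) (cr (al i)) = 2.
Proof.
have iP := base_root D i; set R := \sum_(a <- _ | _) _.
suff : R *m refl (al i) = R - (al i) *+ 2.
  rewrite mul_reflection => /(congr1 (fun x => x - R)); rewrite !(addrC _ (- R)) !addKr.
  move/oppr_inj/(congr1 (fun x => pairing x (cr (al i)))).
  by rewrite pairingZl pairingMnl pairing_coroot //; lia.
have ip : `[< pos (al i) >] by apply/asboolP; apply: base_pos.
rewrite /R -big_filter (bigD1_seq (al i)) ?filter_uniq ?fset_uniq ?mem_filter ?ip //=.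
set S := \sum_(a <- _ | _) _.
rewrite mulmxDl mul_reflection_self // mulr2n opprD addrACA subrr add0r [S - _]addrC.
congr (_ + _); rewrite /S mulmx_suml -big_filter -[RHS]big_filter.
rewrite -(big_map (fun a => a *m refl (al i)) xpredT id).
set L := filter _ _; apply: perm_big.
have uL : uniq L by rewrite !filter_uniq // fset_uniq.
have injr : injective (fun a => a *m refl (al i)).
  by apply: (can_inj (g := fun a => a *m refl (al i))) => a; rewrite -mulmxA reflectionK // mulmx1.
have uL' : uniq [seq a *m refl (al i) | a <- L] by rewrite map_inj_uniq.
have sub : {subset [seq a *m refl (al i) | a <- L] <= L}.
  move=> _ /mapP[a + ->]; rewrite !mem_filter => /and3P[ai /asboolP ap aP].
  have rp := pos_reflection ap ai.
  apply/and3P; split; [|exact/asboolP|exact: pos_root].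
  apply/eqP => E; apply: (@not_posN _ D (al i)); first exact: base_pos.
  have := congr1 (fun x => x *m refl (al i)) E.
  by rewrite -mulmxA reflectionK // mulmx1 mul_reflection_self // => <-.
have [_ E] := uniq_min_size uL' sub (eq_leq (esym (size_map _ _))).
by apply: uniq_perm => // c; rewrite E.
Qed.

(** Twice the sum of the fundamental weights has the same pairings with the simple coroots as
the sum of the positive roots, hence equals it; so halving the latter is exact. *)
Lemma rho_pairing i : pairing (rho D) (cr (al i)) = 1.
Proof.
have [fw [fwP fwE]] := fundamental_weights.
have E : \sum_(a <- Phi | `[< pos a >]) a = (\sum_i fw i) *+ 2.
  rewrite (fwE (\sum_(a <- _ | _) a)) -sumrMnl; apply: eq_bigr => j _.
  by rewrite double_rho_pairing scaler_nat.
have -> : rho D = \sum_i fw i.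
  rewrite /rho E; apply/rowP => j; rewrite [in LHS]mxE mulr2n mxE.
  set s := (\sum_i fw i) 0 j; have -> : s + s = s * 2 by lia.
  by rewrite mulzK.
rewrite pairing_suml (bigD1 i) //= big1 => [|j ji]; last by rewrite fwP (negPf ji).
by rewrite fwP eqxx.
Qed.

End Semisimple.

(** * Stabilizers and orbits of dominant weights *)

Section WeylOrbits.
Variables (n : nat) (D : based_root_datum n).
Local Notation X := 'rV[int]_n.
Local Notation Phi := (root_set D).
Local Notation cr := (coroot D).
Local Notation al := (base D).
Local Notation refl := (reflection_mx D).
Local Notation pos := (positive_root D).
Local Notation form := (root_form D).
Local Notation word := (word D).
Implicit Types (x y : X) (a b : X).

Lemma pos_word s x a : a \in Phi -> dominant D (x *m word s) ->
  0 < pairing x (cr a) -> pos (a *m word s).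
Proof.
move=> aP xd xa; apply: (pos_of_pairing xd (root_word s aP)).
by rewrite pairing_word.
Qed.

Lemma regular_stabilizer x s :
  strictly_dominant D x -> dominant D (x *m word s) -> word s = 1%:M.
Proof.
move=> xs xd; apply: word_pos_eq1 => i.
by apply: pos_word xd (xs i); apply: base_root.
Qed.

(** An element fixing [x] keeps positive the roots that pair positively with [x], so it
preserves all positive roots or it makes exactly [al i] negative. *)
Lemma wall_stabilizer x i s : pairing x (cr (al i)) = 0 ->
  (forall j, j != i -> 0 < pairing x (cr (al j))) ->
  x *m word s = x -> word s = 1%:M \/ word s = refl (al i).
Proof.
move=> xi xj xs; have iP := base_root D i.
have xd : dominant D x.
  by move=> j; have [->|/xj/ltW//] := eqVneq j i; rewrite xi.
have key t : x *m word t = x -> pos (al i *m word t) -> word t = 1%:M.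
  move=> xt ip; apply: word_pos_eq1 => j; have [->//|/xj xj0] := eqVneq j i.
  by apply: pos_word xj0; rewrite ?base_root // xt.
have [ip|iN] := pos_dichotomy (root_word s iP); first by left; apply: key.
right; have := key (i :: s); rewrite /= !mulmxA mul_reflection xi scale0r subr0.
rewrite mul_reflection_self // mulNmx => /(_ xs iN) E.
by rewrite -[LHS]mul1mx -(reflectionK iP) -mulmxA E mulmx1.
Qed.

Hypothesis D_sc : simply_connected D.

Lemma rho_strictly_dominant : strictly_dominant D (rho D).
Proof. by move=> i; rewrite rho_pairing. Qed.

(** If the word [s] makes [al i] negative then [x] lies on the wall of [al i], so [s] can be
replaced with [i :: s]. This adds a positive root to [rho *m word s], which cannot go on
since the form of that weight with [rho] is bounded. *)
Lemma dominant_orbit_eq x s :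
  dominant D x -> dominant D (x *m word s) -> x *m word s = x.
Proof.
move=> xd; set r := rho D.
have rle t : form (r *m word t) r <= form r r.
  have := rform_ge0 D (r - r *m word t).
  by rewrite rformBl !rformBr rform_word (rformC _ r); lia.
have [m] := ubnP `|form r r - form (r *m word s) r|%N.
elim: m s => // m IH s; rewrite ltnS => sm xsd.
have [all_pos|] := pselect (forall i, pos (al i *m word s)).
  by rewrite word_pos_eq1 // mulmx1.
move/existsNP => [i]; have iP := base_root D i.
have [//|iN _] := pos_dichotomy (root_word s iP).
have xi : pairing x (cr (al i)) = 0.
  apply/eqP; rewrite eq_le xd andbT.
  have := dominant_pos_ge0 xsd iN.
  by rewrite corootN ?root_word // pairingNr pairing_word // oppr_ge0.
have xis : x *m word (i :: s) = x *m word s.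
  by rewrite /= mulmxA mul_reflection xi scale0r subr0.
rewrite -xis; apply: IH; last by rewrite xis.
have beta : 0 < form (- (al i *m word s)) r.
  rewrite rformC (rform_root_sg _ (pos_root iN)).
  exact: strictly_dominant_pos_gt0 rho_strictly_dominant iN.
apply: leq_trans sm; move: (rle (i :: s)) (rle s) beta.
rewrite /= mulmxA mul_reflection rho_pairing // scale1r mulmxBl rformBl rformNl.
move: (form r r) (form (r *m word s) r) (form (al i *m word s) r) => u v t.
lia.
Qed.

(** A Weyl group element is determined by the images of the simple coroots. *)
Lemma weyl_finite : finite_set (weyl D).
Proof.
have [fw [_ fwE]] := fundamental_weights D_sc.
pose F (g : {ffun 'I_n -> Phi}) : 'M[int]_n :=
  \matrix_(r, c) \sum_i cr (val (g i)) r 0 * fw i 0 c.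
apply: (sub_finite_set (B := F @` setT)); last exact/finite_image/finite_finset.
move=> _ /weyl_word[s ->].
have rP i : al i *m word (rev s) \in Phi by rewrite root_word ?base_root.
exists [ffun i => FSetSub (rP i)] => //.
apply/matrixP => r c; rewrite mxE.
have := fwE (delta_mx 0 r *m word s); rewrite -rowE => /rowP/(_ c).
rewrite mxE => ->; rewrite summxE; apply: eq_bigr => i _.
rewrite ffunE /= coroot_word ?base_root // revK [RHS]mxE; congr (_ * _).
by rewrite rowE pairing_mulmx delta_pairing.
Qed.

End WeylOrbits.

(** * Coefficients in the group ring *)

Section GroupRingCoefficients.
Variable X : zmodType.
Implicit Types (f g : group_ring X) (x y : X).

(** A function on the alias [group_ring], so that its additivity is stated for the ring
structure on that alias. *)
Definition coef x f : int := f@_x.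

Lemma coefD x f g : coef x (f + g) = coef x f + coef x g.
Proof. exact: mcoeffD. Qed.

Lemma coef0 x : coef x 0 = 0.
Proof. exact: mcoeff0. Qed.

Lemma coefN x f : coef x (- f) = - coef x f.
Proof. exact: mcoeffN. Qed.

Lemma coefMn x f k : coef x (f *+ k) = coef x f *+ k.
Proof. by elim: k => [|k IH]; rewrite ?mulr0n ?coef0 // !mulrS coefD IH. Qed.

Lemma coefMz x f (k : int) : coef x (f *~ k) = coef x f * k.
Proof.
case: k => k; first by rewrite -pmulrn coefMn mulrC -natz mulr_natl.
by rewrite NegzE mulrNz coefN -pmulrn coefMn mulrN mulrC -natz mulr_natl.
Qed.

Lemma coef_sum I (r : seq I) (P : pred I) (F : I -> group_ring X) x :
  coef x (\sum_(i <- r | P i) F i) = \sum_(i <- r | P i) coef x (F i).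
Proof.
elim/big_rec2: _ => [|i u v _ <-]; first exact: coef0.
by rewrite coefD.
Qed.

Lemma coef_ebasis x y : coef x (ebasis y) = (y == x)%:R.
Proof. exact: mcoeffU. Qed.

Lemma coef_supp f x : (x \in msupp f) = (coef x f != 0).
Proof. by rewrite -mcoeff_neq0. Qed.

Lemma coefE f x : coef x f = \sum_(y <- msupp f) coef y f * (y == x)%:R.
Proof.
have [xf|xf] := boolP (x \in msupp f).
  rewrite (bigD1_seq x) ?fset_uniq //= eqxx mulr1 big1 ?addr0 // => y /negPf ->.
  by rewrite mulr0.
rewrite big1_seq => [|y /andP[_ yf]]; first by apply/eqP; rewrite -[_ == _]negbK -coef_supp.
by case: eqP yf => [->|_ _]; rewrite ?(negPf xf) //= mulr0n mulr0.
Qed.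

Lemma coef_ebasis_mul x y g : coef x (ebasis y * g) = coef (x - y) g.
Proof.
have -> : ebasis y * g = \sum_(z <- msupp g) << 1 * g@_z *g y + z >> :> group_ring X.
  rewrite -[LHS]/(gr_mul _ _) [in LHS](monalgE g) gr_mul_sumr.
  by apply: eq_bigr => z _; rewrite gr_mulUU.
rewrite coef_sum coefE; apply: eq_bigr => z _.
rewrite [LHS]mcoeffU mul1r [RHS]mulr_natr.
by rewrite [_ == x - y]eq_sym subr_eq eq_sym addrC.
Qed.

Lemma coef_mulrz_ebasis x y g (k : int) : coef x ((ebasis y *~ k) * g) = k * coef (x - y) g.
Proof. by rewrite mulrzAl coefMz coef_ebasis_mul mulrC. Qed.

End GroupRingCoefficients.

(** * Weyl characters and orbit sums *)

Section Characters.
Variables (n : nat) (D : based_root_datum n).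
Hypothesis D_sc : simply_connected D.
Local Notation X := 'rV[int]_n.
Local Notation cr := (coroot D).
Local Notation al := (base D).
Local Notation W := (fset_set (weyl D)).
Implicit Types (x y l m : X) (eta f g : group_ring X).

Lemma in_W w : (w \in W) = (w \in weyl D).
Proof. by rewrite in_fset_set //; apply: weyl_finite. Qed.

Lemma alternating_sumE l :
  alternating_sum D l = \sum_(w <- W) ebasis (l *m w) *~ \det w.
Proof. by rewrite /alternating_sum fsbig_finite //; apply: weyl_finite. Qed.

Lemma coef_alternating_mul x l g :
  coef x (alternating_sum D l * g) = \sum_(w <- W) \det w * coef (x - l *m w) g.
Proof.
rewrite alternating_sumE mulr_suml coef_sum; apply: eq_bigr => w _.
exact: coef_mulrz_ebasis.
Qed.

Lemma coef_alternating_regular l m : strictly_dominant D l -> strictly_dominant D m ->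
  coef m (alternating_sum D l) = (l == m)%:R.
Proof.
move=> ls ms; rewrite alternating_sumE coef_sum.
under eq_bigr do rewrite coefMz coef_ebasis.
have W1 : 1%:M \in W by rewrite in_W; apply/mem_set; left.
rewrite (bigD1_seq 1%:M) ?fset_uniq //= mulmx1 det1 mulr1 big1_seq ?addr0 //.
move=> w /andP[w1]; rewrite in_W => /set_mem/weyl_word[s wE]; subst w.
case: eqP => [E|_]; last by rewrite mul0r.
case/eqP: w1; apply: (regular_stabilizer ls).
by rewrite E; apply: strictly_dominantW.
Qed.

(** The second case is the default value of [xget]. *)
Lemma weyl_character_spec l :
  alternating_sum D (rho D) * weyl_character D l = alternating_sum D (l + rho D) \/
  weyl_character D l = 0.
Proof. by rewrite /weyl_character; case: xgetP; [left|right]. Qed.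

Lemma fsbig_mulrz (T : choiceType) (R : zmodType) (P : set T) (F : T -> R) (b : T -> int) :
  finite_set (P `&` [set x | b x != 0]) ->
  \sum_(x \in P) F x *~ b x = \sum_(x <- fset_set (P `&` [set x | b x != 0])) F x *~ b x.
Proof.
move=> fin; rewrite -fsbig_finite //; apply/esym/fsbig_widen; first by move=> x [].
by move=> x [Px /= /not_andP[//|/negP]]; rewrite negbK => /eqP ->; rewrite mulr0z.
Qed.

Lemma strictly_dominantD_rho l : dominant D l -> strictly_dominant D (l + rho D).
Proof. by move=> ld i; rewrite pairingDl rho_pairing //; have := ld i; lia. Qed.

(** Multiplication by [A(rho)] replaces every Weyl character in the expansion with an
alternating sum or with zero. *)
Lemma good_filtration_coef_ge0 l x eta :
  good_filtration_character D (weyl_character D l * eta) -> strictly_dominant D x ->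
  0 <= coef x (alternating_sum D (l + rho D) * eta).
Proof.
case=> ne0 _ [b [bfin b0 bE]] xs.
have [<-|E] := weyl_character_spec l; last by rewrite E mul0r eqxx in ne0.
rewrite -mulrA bE fsbig_mulrz // mulr_sumr coef_sum big_seq; apply: sumr_ge0 => m.
rewrite in_fset_set // => /set_mem[md _]; rewrite mulrzAr coefMz mulr_ge0 ?b0 //.
have [->|->] := weyl_character_spec m; last by rewrite mulr0 coef0.
by rewrite coef_alternating_regular //; apply: strictly_dominantD_rho.
Qed.

Lemma weyl_orbit_finite m : finite_set (weyl_orbit D m).
Proof. exact/finite_image/weyl_finite. Qed.

Lemma coef_orbit_sum m x : dominant D m -> dominant D x ->
  coef x (orbit_sum D m) = (m == x)%:R.
Proof.
move=> md xd; have fin := weyl_orbit_finite m.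
rewrite /orbit_sum fsbig_finite // coef_sum; under eq_bigr do rewrite coef_ebasis.
have mo : m \in fset_set (weyl_orbit D m).
  by rewrite in_fset_set //; apply/mem_set; exists 1%:M; [left|rewrite mulmx1].
rewrite (bigD1_seq m) ?fset_uniq //= big1_seq ?addr0 // => y /andP[ym].
rewrite in_fset_set // => /set_mem[_ /weyl_word[s ->] yE]; case: eqP => // yx.
by case/eqP: ym; rewrite -yE dominant_orbit_eq // yE yx.
Qed.

Lemma coef_orbit_sums (c : X -> int) x :
  finite_set (dominant D `&` [set m | c m != 0]) -> dominant D x ->
  coef x (\sum_(m \in dominant D) orbit_sum D m *~ c m) = c x.
Proof.
move=> fin xd; rewrite fsbig_mulrz // coef_sum.
transitivity (\sum_(m <- fset_set (dominant D `&` [set m | c m != 0])) (m == x)%:R * c m).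
  apply: eq_big_seq => m; rewrite in_fset_set // => /set_mem[md _].
  by rewrite coefMz coef_orbit_sum.
have [cx|cx] := eqVneq (c x) 0.
  by rewrite cx big1 // => m _; case: eqP => [->|]; rewrite ?cx ?mulr0 ?mul0r.
rewrite (bigD1_seq x) ?fset_uniq ?in_fset_set //=; last by apply/mem_set.
by rewrite eqxx mul1r big1 ?addr0 // => m /negPf ->; rewrite mul0r.
Qed.

Lemma coef_weyl_invariant eta x s : weyl_invariant D eta ->
  coef (x *m word D s) eta = coef x eta.
Proof.
move=> inv; rewrite -{1}(inv _ (word_weyl D s)) /weyl_act coef_sum [RHS]coefE.
apply: eq_bigr => y _; rewrite coefMz coef_ebasis mulrC; congr (_ * (_ : bool)%:R).
apply/eqP/eqP => [E|->//]; have := congr1 (fun z => z *m word D (rev s)) E.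
by rewrite -!mulmxA word_revr !mulmx1.
Qed.

End Characters.

(** * Coefficients decrease away from the origin *)

Section Monotonicity.
Variables (n : nat) (D : based_root_datum n).
Hypothesis D_sc : simply_connected D.
Local Notation X := 'rV[int]_n.
Local Notation Phi := (root_set D).
Local Notation cr := (coroot D).
Local Notation al := (base D).
Local Notation refl := (reflection_mx D).
Local Notation W := (fset_set (weyl D)).
Implicit Types (x y nu : X).

Let size1 x : nat := (\sum_j `|x 0%R j|)%N.

Let size1_coord x j : (`|x 0%R j| <= size1 x)%N.
Proof. by rewrite /size1 (bigD1 j) //= leq_addr. Qed.

Lemma far_translate_coef0 eta u : u != 0 -> forall x, exists N0, forall N, (N0 <= N)%N ->
  coef (x + u *+ N) eta = 0.
Proof.
move=> u0 x; pose N0 := (size1 x + \sum_(y <- msupp eta) size1 y).+1.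
exists N0 => N N0N; apply/eqP; rewrite -[_ == _]negbK -coef_supp; apply/negP => yE.
have /existsP[j uj] : [exists j, u 0 j != 0].
  apply/existsPn => u0j; case/eqP: u0; apply/rowP => j; rewrite mxE.
  by apply/eqP; rewrite -[_ == _]negbK u0j.
have := size1_coord (x + u *+ N) j; have := size1_coord x j.
move: N0N; rewrite /N0 (bigD1_seq _ yE) ?fset_uniq //= -scaler_nat !mxE.
move: (size1 _) (size1 _) (\sum_(i <- _ | _) _)%N (u 0 j) (x 0 j) uj => s1 s2 s3 uu xx.
rewrite natz => uu0 N0N x1.
have : `|uu * N%:Z| = `|uu| * N%:Z by rewrite normrM.
have : N%:Z <= `|uu| * N%:Z by rewrite ler_peMl // -gtz0_ge1 normr_gt0.
move: (N%:Z * uu) (uu * N%:Z) (mulrC uu N%:Z); lia.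
Qed.

Section Bound.
Variables (q : nat) (eta : group_ring X).
Hypothesis q_gt0 : (0 < q)%N.
Hypothesis alt_ge0 : forall l x, strictly_dominant D l -> strictly_dominant D x ->
  0 <= coef x (alternating_sum D (l *+ q) * eta).
Hypothesis eta_inv : weyl_invariant D eta.

Lemma sum_identity_reflection (F : 'M[int]_n -> int) i :
  (forall w, weyl D w -> w != 1%:M -> w != refl (al i) -> F w = 0) ->
  \sum_(w <- W) F w = F 1%:M + F (refl (al i)).
Proof.
move=> F0; have iP := base_root D i.
have W1 : 1%:M \in W by rewrite in_W //; apply/mem_set; left.
have Wi : refl (al i) \in W.
  by rewrite in_W //; apply/mem_set; have := word_weyl D [:: i]; rewrite /= mulmx1.
have i1 : refl (al i) != 1%:M.
  by apply/eqP => /(congr1 determinant); rewrite det_reflection // det1.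
rewrite (bigD1_seq 1%:M) ?fset_uniq //=; congr (_ + _).
rewrite big_mkcond (bigD1_seq (refl (al i))) ?fset_uniq //= i1 big1_seq ?addr0 //.
by move=> w /andP[wi]; rewrite in_W // => /set_mem Ww; case: ifP => // w1; apply: F0.
Qed.

(** Compare coefficients at [nu + q th] where [th] has pairing [m] with the coroot of [al i]
and pairing [N] with the other simple coroots. For large [N], only the stabilizer of the wall
of [al i] contributes. *)
Lemma simple_translate_le i (m : nat) nu : (0 < m)%N ->
  0 < pairing nu (cr (al i)) + (q * m)%:Z ->
  coef (nu + al i *+ (q * m)) eta <= coef nu eta.
Proof.
move=> m0 num; have iP := base_root D i.
have [fw [fwP _]] := fundamental_weights D_sc.
pose tau := \sum_(j | j != i) fw j.
have tauP j : pairing tau (cr (al j)) = (j != i)%:R.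
  rewrite pairing_suml; have [->|ji] := eqVneq j i.
    by rewrite big1 // => k /negPf ki; rewrite fwP ki.
  rewrite (bigD1 j) //= fwP eqxx big1 ?addr0 // => k /andP[_ /negPf kj].
  by rewrite fwP kj.
(* the argument of eta in the term of w is nu + v w + u w *+ N *)
pose v w := (fw i - fw i *m w) *+ (q * m); pose u w := (tau - tau *m w) *+ q.
have [N1 N1P] : exists N1, forall N w, (N1 <= N)%N -> weyl D w -> w != 1%:M ->
    w != refl (al i) -> coef (nu + v w + u w *+ N) eta = 0.
  have /choice[g gP] : forall w, exists N0, forall N, (N0 <= N)%N -> weyl D w ->
      w != 1%:M -> w != refl (al i) -> coef (nu + v w + u w *+ N) eta = 0.
    move=> w; have [uw|uw] := eqVneq (u w) 0; last first.
      by have [N0 N0P] := far_translate_coef0 eta uw (nu + v w); exists N0 => N /N0P.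
    exists 0%N => N _ /weyl_word[s ws] w1 wi; subst w; exfalso.
    have tw : tau *m word D s = tau.
      apply/esym/eqP; rewrite -subr_eq0; move/eqP: uw.
      by rewrite /u -scaler_nat scalemx_eq0 pnatr_eq0 eqn0Ngt q_gt0.
    have ti : pairing tau (cr (al i)) = 0 by rewrite tauP eqxx.
    have tj j : j != i -> 0 < pairing tau (cr (al j)) by move=> ji; rewrite tauP ji.
    by have [E|E] := wall_stabilizer ti tj tw; [rewrite E eqxx in w1|rewrite E eqxx in wi].
  exists (\sum_(w <- W) g w)%N => N w gN Ww; apply: gP => //.
  apply: leq_trans gN; rewrite (bigD1_seq w) ?fset_uniq ?leq_addr //=.
  by rewrite in_W //; apply/mem_set.
(* the second summand makes nu + q th strictly dominant *)
pose N := (N1 + \sum_j `|pairing nu (cr (al j))|).+1%N.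
pose th := fw i *+ m + tau *+ N; pose x := nu + th *+ q.
have thP j : pairing th (cr (al j)) = if j == i then m%:Z else N%:Z.
  rewrite pairingDl !pairingMnl tauP fwP (eq_sym i) -!mulrnA !natz.
  by case: (j == i) => /=; lia.
have ths : strictly_dominant D th by move=> j; rewrite thP; case: ifP.
have xs : strictly_dominant D x.
  move=> j; rewrite pairingDl pairingMnl thP -mulr_natl natz; case: eqP => [->|_].
    by move: num; rewrite PoszM.
  have : (`|pairing nu (cr (al j))| < N)%N.
    by rewrite /N ltnS (bigD1 j) //=; lia.
  have : (N <= q * N)%N by rewrite leq_pmull.
  by lia.
have := alt_ge0 ths xs; rewrite coef_alternating_mul // (@sum_identity_reflection _ i).
  rewrite det1 det_reflection // mul1r mulN1r subr_ge0 mulmx1 addrK.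
  rewrite mul_reflection pairingMnl thP eqxx -mulr_natl natz -PoszM -natz scaler_nat.
  by rewrite opprB addrA addrAC addrK.
move=> w Ww w1 wi; suff -> : x - th *+ q *m w = nu + v w + u w *+ N.
  by rewrite N1P ?mulr0 // /N; lia.
rewrite /x /th /v /u -!scaler_nat -scalemxAl mulmxDl -!scalemxAl.
move: (fw i *m w) (tau *m w) => fww tauw; apply/rowP => j; rewrite !mxE !natz PoszM.
by ring.
Qed.

Lemma coef_reflection_base x i : coef (x - pairing x (cr (al i)) *: al i) eta = coef x eta.
Proof.
rewrite -mul_reflection -(coef_weyl_invariant x [:: i] eta_inv) /=.
by rewrite mulmx1.
Qed.

(** Conjugation reduces to a simple root. There the image of [y] is its linear reflection
[nu] translated by [q l] times the root; when [y] lies on the hyperplane or [l = 0], the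
claim is an equality given by Weyl invariance. *)
Lemma affine_reflection_le b (l : nat) x : b \in Phi -> pairing x (cr b) <= l%:Z * q%:Z ->
  coef (x - (pairing x (cr b) - l%:Z * q%:Z) *: b) eta <= coef x eta.
Proof.
move=> bP; have [i [s bE]] := root_conj bP; have iP := base_root D i.
have [y ->] : exists y, x = y *m word D s.
  by exists (x *m word D (rev s)); rewrite -mulmxA word_rev mulmx1.
rewrite bE pairing_word // scalemxAl -mulmxBl !coef_weyl_invariant //.
set k := pairing y _; set nu := y - k *: al i => kl.
have nuE : coef nu eta = coef y eta by apply: coef_reflection_base.
have nuP : pairing nu (cr (al i)) = - k.
  by rewrite pairingBl pairingZl pairing_coroot // /k; lia.
have -> : y - (k - l%:Z * q%:Z) *: al i = nu + al i *+ (q * l).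
  rewrite scalerBl opprB addrCA [LHS]addrC /nu.
  by rewrite -[in RHS]scaler_nat natz PoszM (mulrC q%:Z).
have [lk|] := eqVneq k (l%:Z * q%:Z); last first.
  case: l kl => [|l] kl kne; first by rewrite muln0 mulr0n addr0 nuE.
  rewrite -nuE; apply: simple_translate_le => //.
  by rewrite nuP PoszM; move: kl kne; lia.
suff -> : nu + al i *+ (q * l) = y by [].
by rewrite /nu lk -scaler_nat natz PoszM (mulrC q%:Z) subrK.
Qed.

End Bound.
End Monotonicity.

(** * Descent along the dominance order *)

Section Descent.
Variables (n : nat) (D : based_root_datum n).
Hypothesis D_sc : simply_connected D.
Local Notation X := 'rV[int]_n.
Local Notation cr := (coroot D).
Local Notation al := (base D).
Implicit Types (x y mu : X) (f : X -> int).

(** Dominance of [mu] makes the simple root given by [descent_direction] for [x - mu] pair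
positively with [x] itself. *)
Lemma descend_to_dominant f mu x :
  (forall i y, 0 < pairing y (cr (al i)) -> f y <= f (y - al i)) ->
  dominant D mu -> dominance_le D mu x -> f x <= f mu.
Proof.
move=> fstep mud [k]; have [m] := ubnP (\sum_i k i)%N.
elim: m k x => // m IH k x; rewrite ltnS => km xk.
have xE : x - mu = \sum_i (k i)%:Z *: al i.
  by rewrite xk; apply: eq_bigr => i _; rewrite -scaler_nat natz.
have [/subr0_eq ->//|ne] := eqVneq (x - mu) 0.
have [i [ki xi]] := descent_direction xE (rform_gt0 D_sc ne).
have xi' : 0 < pairing x (cr (al i)).
  by move: xi; rewrite pairingBl; have := mud i; lia.
apply: le_trans (fstep i x xi') _.
apply: (IH (fun j => k j - (j == i))%N).
  apply: leq_trans km; rewrite [X in (X < _)%N](bigD1 i) //= [X in (_ < X)%N](bigD1 i) //= eqxx.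
  rewrite (eq_bigr k) => [|j /negPf ->]; last by rewrite subn0.
  by rewrite ltn_add2r; lia.
rewrite addrAC xk (bigD1 i) //= [RHS](bigD1 i) //= eqxx.
rewrite [X in _ = _ + X](eq_bigr (fun j => al j *+ k j)) => [|j /negPf ->]; last by rewrite subn0.
by rewrite addrAC mulrnBr.
Qed.

End Descent.

(** * Moving the base point across affine hyperplanes *)

Section Folding.
Variables (n p : nat) (D : based_root_datum n).
Local Notation X := 'rV[int]_n.
Local Notation Phi := (root_set D).
Local Notation cr := (coroot D).
Local Notation al := (base D).
Local Notation refl := (reflection_mx D).
Local Notation pos := (positive_root D).
Implicit Types (x y mu : X) (f : X -> int) (a b : X) (k l : int).

Definition affine_reflection a k x : X := x - (pairing x (cr a) - k * p%:Z) *: a.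
Local Notation aff := affine_reflection.

Lemma affine_reflectionN a k x : a \in Phi -> aff (- a) (- k) x = aff a k x.
Proof.
by move=> aP; rewrite /aff corootN // pairingNr mulNr -opprD scaleNr scalerN opprK.
Qed.

Lemma affine_reflectionK a k x : a \in Phi -> aff a k (aff a k x) = x.
Proof.
move=> aP; rewrite /aff pairingBl pairingZl pairing_coroot //.
set t := _ - k * _; rewrite -addrA -opprD -scalerDl.
have -> : t + (pairing x (cr a) - t * 2 - k * p%:Z) = 0 by rewrite /t; ring.
by rewrite scale0r subr0.
Qed.

(** The level of the hyperplane [<x, b^vee> = l p] after the reflection in the hyperplane
[<x, a^vee> = k p]. *)
Definition conj_level a k b l := l - k * pairing a (cr b).

Lemma pairing_conj a k b l x : a \in Phi -> b \in Phi ->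
  pairing (aff a k x) (cr (b *m refl a)) - conj_level a k b l * p%:Z =
  pairing x (cr b) - l * p%:Z.
Proof.
move=> aP bP; rewrite coroot_reflection // reflection_mul /aff /conj_level.
rewrite pairingBr pairingZr !pairingBl !pairingZl pairing_coroot //.
by ring.
Qed.

Lemma affine_reflection_conj a k b l x : a \in Phi -> b \in Phi ->
  aff a k (aff b l x) = aff (b *m refl a) (conj_level a k b l) (aff a k x).
Proof.
move=> aP bP; rewrite {3}/aff pairing_conj // /aff.
set t := pairing x (cr b) - _; rewrite pairingBl pairingZl mul_reflection.
rewrite scalerBr; apply/rowP => j; rewrite !mxE; ring.
Qed.

Definition decreasing f b l :=
  forall x, pairing x (cr b) <= l * p%:Z -> f (aff b l x) <= f x.

Variables (gam : X) (N : nat).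
Hypothesis gam_dom : strictly_dominant D gam.
Hypothesis N_gt0 : (0 < N)%N.
Local Notation g := (fun b => pairing gam (cr b)).

(** The base point is [- (j / N) p gam]; the inequality says that it lies on the side
[<x, b^vee> <= l p]. The pair [(- b, - l)] describes the same hyperplane seen from the other
side, so for a base point on a hyperplane both directions are required. *)
Definition oriented (j : nat) f := forall b l, b \in Phi ->
  0 <= l * N%:Z + j%:Z * g b -> decreasing f b l.

(** The ray meets the hyperplane [<x, a^vee> = k p] strictly after tick [j] and not after
tick [j + 1]. *)
Definition crossing (j : nat) a k :=
  pos a /\ k * N%:Z + j%:Z * g a < 0 <= k * N%:Z + j.+1%:Z * g a.

(** Folding along the hyperplane crossed during the tick. Reflections in the other
hyperplanes are compared with the crossing point, which has parameter [- k / g a] on the ray: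
it lies strictly on the side [<x, b^vee> < l p] if and only if [k * g b < l * g a], and this
condition is preserved by the reflection in the hyperplane crossed. *)
Lemma oriented_step j f :
  (forall a b k l, crossing j a k -> crossing j b l -> a = b /\ k = l) ->
  oriented j f -> exists f', [/\ oriented j.+1 f', forall x, f x <= f' x &
    forall mu, dominant D mu -> f' mu = f mu].
Proof.
move=> uniq_cross fj.
have g_sign b : b \in Phi -> 0 < g b /\ pos b \/ g b < 0 /\ pos (- b).
  move=> bP; have [bp|bn] := pos_dichotomy bP; [left|right]; split=> //.
    exact: strictly_dominant_pos_gt0.
  by have := strictly_dominant_pos_gt0 gam_dom bn; rewrite corootN // pairingNr oppr_gt0.
have cross_pos b l : b \in Phi -> l * N%:Z + j%:Z * g b < 0 ->
    0 <= l * N%:Z + j.+1%:Z * g b -> crossing j b l.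
  move=> bP lt0 ge0; split; last by rewrite lt0.
  have [[//]|[gb _]] := g_sign b bP.
  by move: lt0 ge0; rewrite intS; move: (g b) gb => u; nia.
have [none|] := pselect (forall a k, ~ crossing j a k).
  exists f; split=> // b l bP l0; have [|lt0] := lerP 0 (l * N%:Z + j%:Z * g b); first exact: fj.
  by case: (none b l); apply: cross_pos.
move/existsNP => [a /existsNP[k /contrapT cr_ak]].
have [ap /andP[k_lt k_ge]] := cr_ak; have aP := pos_root ap.
have ga : 0 < g a := strictly_dominant_pos_gt0 gam_dom ap.
have N0 : 0 < N%:Z :> int by [].
(* reflections away from the crossing point are reflections away from the old base point *)
have before b l : b \in Phi -> k * g b < l * g a -> decreasing f b l.
  move=> bP lk; apply: fj => //; rewrite leNgt; apply/negP => lt0.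
  have [[gb bp]|[gb bn]] := g_sign b bP; last first.
    by move: (g a) (g b) ga gb k_lt lk lt0 => u v; nia.
  have [|ab kl] := uniq_cross _ _ _ _ cr_ak (cross_pos b l bP lt0 _).
    by move: (g a) (g b) ga gb k_ge lk => u v; rewrite intS; nia.
  by move: lk; rewrite -ab -kl ltxx.
(* reflections away from the new base point are reflections away from the crossing point,
   except for the hyperplane crossed *)
have after b l : b \in Phi -> 0 <= l * N%:Z + j.+1%:Z * g b ->
    [\/ b = a /\ l = k, b = - a /\ l = - k | k * g b < l * g a].
  move=> bP l0; have [|lk] := ltrP (k * g b) (l * g a); first by constructor 3.
  have [[gb bp]|[gb bn]] := g_sign b bP.
    constructor 1; have [|-> ->//] := uniq_cross _ _ _ _ cr_ak (cross_pos b l bP _ l0).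
    by move: (g a) (g b) ga gb k_lt lk => u v; nia.
  constructor 2.
  have [||E1 E2] := uniq_cross _ _ _ _ cr_ak (cross_pos (- b) (- l) (opp_root bP) _ _).
  - rewrite corootN // pairingNr; move: l0 lk k_ge; rewrite intS.
    by move: (g a) (g b) ga gb => u v; nia.
  - rewrite corootN // pairingNr; move: l0 lk k_ge; rewrite intS.
    by move: (g a) (g b) ga gb => u v; nia.
  by rewrite E1 E2 !opprK.
exists (fun x => Num.max (f x) (f (aff a k x))); split.
- move=> b l bP l0 x xb; have [[-> ->]|[-> ->]|lk] := after b l bP l0.
  + by rewrite affine_reflectionK // maxC.
  + by rewrite affine_reflectionN // affine_reflectionK // maxC.
  rewrite ge_max !le_max before //= affine_reflection_conj //.
  apply/orP; right; apply: before.
  + exact: root_reflection.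
  + rewrite coroot_reflection // reflection_mul pairingBr pairingZr /conj_level.
    by move: lk; rewrite !(mulrBl, mulrBr) !mulrA; lia.
  by rewrite -subr_le0 pairing_conj // subr_le0.
- by move=> x; rewrite le_max lexx.
move=> mu mud; apply/eqP; rewrite eq_le le_max lexx andbT ge_max lexx /=.
rewrite -affine_reflectionN //; apply: fj; first exact: opp_root.
  by rewrite corootN // pairingNr mulrN mulNr -opprD oppr_ge0 ltW.
have := dominant_pos_ge0 mud ap; rewrite corootN // pairingNr => mua.
have k0 : k < 0 by move: (g a) ga k_lt => u; nia.
by move: k0 mua; nia.
Qed.

Lemma oriented_iter J f :
  (forall j a b k l, (j < J)%N -> crossing j a k -> crossing j b l -> a = b /\ k = l) ->
  oriented 0 f -> exists f', [/\ oriented J f', forall x, f x <= f' x &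
    forall mu, dominant D mu -> f' mu = f mu].
Proof.
elim: J => [|J IH] uniq_cross f0; first by exists f.
have [j a b k l jJ|//|f1 [o1 le1 eq1]] := IH _ _; first by apply: uniq_cross; rewrite ltnS ltnW.
have [a b k l|f2 [o2 le2 eq2]] := oriented_step _ o1; first exact: uniq_cross.
exists f2; split=> // [x|mu mud]; first exact: le_trans (le1 x) (le2 x).
by rewrite eq2 ?eq1.
Qed.

End Folding.

(** * A generic direction *)

(** Uniqueness of the expansion in base [M]. *)
Lemma digits_eq0 n (d : nat -> int) (M : nat) :
  (forall i, `|d i| < M%:Z) -> \sum_(i < n) d i * M%:Z ^+ i = 0 ->
  forall i, (i < n)%N -> d i = 0.
Proof.
elim: n d => // n IH d dM; rewrite big_ord_recl expr0 mulr1.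
under eq_bigr do rewrite lift0 exprSr mulrA.
rewrite -mulr_suml; set S := \sum_(i < n) _ => d0S.
have S0 : S = 0.
  apply: contraTeq (dM 0%N) => S0; have -> : d 0%N = - (S * M%:Z).
    by apply/eqP; rewrite -addr_eq0; apply/eqP.
  by rewrite normrN normrM -leNgt ler_peMl // -gtz0_ge1 normr_gt0.
move: d0S; rewrite S0 mul0r addr0 => d0 [//|i] iN.
exact: (IH (fun i => d i.+1)).
Qed.

(** Two crossings in the same tick have parameters [- k / u] and [- l / v], whose difference
is a multiple of [1 / (u v)] smaller than [1 / N]. *)
Lemma near_crossings_proportional (N u v k l j : int) : 0 < u -> 0 < v -> u * v < N ->
  k * N + j * u < 0 <= k * N + (j + 1) * u ->
  l * N + j * v < 0 <= l * N + (j + 1) * v -> k * v = l * u.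
Proof.
move=> u0 v0 uvN /andP[ku uk] /andP[lv vl].
have {}ku : k * v * N < - (j * (u * v)) by nia.
have {}uk : - ((j + 1) * (u * v)) <= k * v * N by nia.
have {}lv : l * u * N < - (j * (u * v)) by nia.
have {}vl : - ((j + 1) * (u * v)) <= l * u * N by nia.
move: (u * v) (k * v) (l * u) uvN ku uk lv vl (mulr_gt0 u0 v0) => w x y.
nia.
Qed.

Section GenericDirection.
Variables (n : nat) (D : based_root_datum n).
Hypothesis D_sc : simply_connected D.
Local Notation X := 'rV[int]_n.
Local Notation Phi := (root_set D).
Local Notation cr := (coroot D).
Local Notation al := (base D).
Local Notation pos := (positive_root D).
Local Notation form := (root_form D).

(** Proportional coroots belong to proportional roots, since [form a a *: cr a] depends
linearly on [a] as a functional. *)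
Lemma proportional_coroots a b (k l : int) : pos a -> pos b -> 0 < k ->
  k *: cr b = l *: cr a -> a = b.
Proof.
move=> ap bp k0 E; have aP := pos_root ap; have bP := pos_root bp.
pose v := (k * form a a) *: b - (l * form b b) *: a.
have v0 : v = 0.
  apply/eqP; apply: contraT => /(rform_gt0 D_sc); rewrite {2}/v rformBr !rformZr.
  have := congr1 (pairing v) E; rewrite !pairingZr.
  have := rform_root v aP; have := rform_root v bP.
  move: (form a a) (form b b) (form v a) (form v b) (pairing v (cr b)) (pairing v (cr a)).
  move=> u w x y s t yE xE st; suff : (k * u * y - l * w * x) *+ 2 = 0 by lia.
  transitivity (k * u * (y *+ 2) - l * w * (x *+ 2)); first by ring.
  rewrite yE xE; transitivity (u * w * (k * s - l * t)); first by ring.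
  by rewrite st subrr mulr0.
have {}E : (k * form a a) *: b = (l * form b b) *: a by apply/eqP; rewrite -subr_eq0; apply/eqP.
have kb : k * form a a != 0 by rewrite mulf_neq0 ?gt_eqF // rform_root_gt0.
have [//|aE] := root_reduced bP aP kb E.
by case: (not_posN bp); rewrite -aE.
Qed.

(** A tick number [J] after which the hyperplanes of level at least [- K] have been passed, in
a direction for which no tick up to [J] crosses two hyperplanes. The pairings of [gam] with
positive coroots are polynomials in a large integer [M]; they lie between [M ^ n] and a fixed
multiple of it, whatever [M] is, so the levels of the hyperplanes met up to tick [J] are
bounded independently of [M]. Two simultaneous crossings give a relation
with bounded coefficients between the powers of [M], hence proportional coroots. *)
Lemma generic_direction (K : nat) : exists gam N J,
  [/\ strictly_dominant D gam, (0 < N)%N,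
    forall a (k : int), pos a -> - K%:Z <= k ->
      0 <= k * N%:Z + J%:Z * pairing gam (cr a) &
    forall j a b (k l : int), (j < J)%N -> crossing D gam N j a k ->
      crossing D gam N j b l -> a = b /\ k = l].
Proof.
have [fw [fwP fwE]] := fundamental_weights D_sc.
pose c i a := pairing (fw i) (cr a); pose h a := \sum_i c i a.
have c0 i a : pos a -> 0 <= c i a.
  by move=> ap; apply: dominant_pos_ge0 ap => j; rewrite fwP; case: (i == j).
have ch i a : pos a -> c i a <= h a.
  by move=> ap; rewrite /h (bigD1 i) //= lerDl sumr_ge0 // => j _; apply: c0.
have h1 a : pos a -> 1 <= h a.
  move=> ap; rewrite -gtz0_ge1 /h -pairing_suml; apply: strictly_dominant_pos_gt0 ap => j.
  rewrite pairing_suml (bigD1 j) //= fwP eqxx big1 // => i /negPf ij.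
  by rewrite fwP ij.
pose R := (\sum_(a <- Phi) `|h a|)%N.
have hR a : pos a -> h a <= R%:Z.
  move=> ap; rewrite /R (bigD1_seq a) ?fset_uniq ?pos_root //=.
  by move: (h a) (\sum_(i <- _ | _) _)%N => u v; lia.
(* B bounds the levels met, and M exceeds all the digits that occur below *)
pose B := (K * (2 * R))%N; pose M := (2 * (B * R)).+1%N.
pose gam := \sum_(i < n) (M%:Z ^+ n + M%:Z ^+ i) *: fw i.
have gamE a : pairing gam (cr a) = h a * M%:Z ^+ n + \sum_(i < n) c i a * M%:Z ^+ i.
  rewrite pairing_suml /h mulr_suml -big_split; apply: eq_bigr => i _.
  by rewrite pairingZl mulrDl ![_ ^+ _ * _]mulrC.
have M1 (i : nat) : 0 < M%:Z ^+ i :> int by apply: exprn_gt0.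
have Mle (i : nat) : (i < n)%N -> M%:Z ^+ i <= M%:Z ^+ n.
  by move=> iN; apply: ler_weXn2l => //; apply: ltnW.
have g_lower a : pos a -> M%:Z ^+ n <= pairing gam (cr a).
  move=> ap; rewrite gamE -[X in X <= _]addr0 lerD //; last first.
    by apply: sumr_ge0 => i _; rewrite mulr_ge0 ?c0 // ltW.
  by rewrite ler_peMl ?h1 // ltW.
have g_upper a : pos a -> pairing gam (cr a) <= (2 * R)%:Z * M%:Z ^+ n.
  move=> ap; have : \sum_(i < n) c i a * M%:Z ^+ i <= h a * M%:Z ^+ n.
    by rewrite /h mulr_suml; apply: ler_sum => i _; rewrite ler_wpM2l ?c0 // Mle.
  rewrite gamE; have := hR a ap; have := M1 n.
  by move: (h a) (M%:Z ^+ n) (\sum_(i < n) _) => u v w; nia.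
have gam_dom : strictly_dominant D gam.
  by move=> i; apply: lt_le_trans (M1 n) (g_lower _ (base_pos D i)).
(* G bounds the pairings of gam; N exceeds the product of any two of them, its
   factor M ^ n, a lower bound for the pairings, lets J ticks pass every level down to - K *)
pose G := (2 * R * M ^ n)%N; pose N := (M ^ n * (G * G).+1)%N; pose J := (K * (G * G).+1)%N.
have ME : (M ^ n)%:Z = M%:Z ^+ n by rewrite -!natz natrX.
exists gam, N, J; split=> //.
- by rewrite muln_gt0 expn_gt0.
- move=> a k ap kK; have := g_lower a ap; rewrite -ME /N /J !PoszM.
  move: (pairing _ _) (M ^ n)%N ((G * G).+1) => u v w vu.
  have uv : 0 <= k * v%:Z + K%:Z * u by move: kK vu; nia.
  by rewrite (_ : _ + _ = w%:Z * (k * v%:Z + K%:Z * u)) ?mulr_ge0 //; ring.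
have cross_bound j a k : (j < J)%N -> crossing D gam N j a k -> 0 < - k <= B%:Z.
  move=> jJ [ap /andP[]]; have := g_upper a ap; have := g_lower a ap; have := M1 n; rewrite -ME.
  move: jJ; rewrite /N /B /J !PoszM intS.
  move: (pairing _ _) (M ^ n)%N ((G * G).+1) (ltn0Sn (G * G)) => u v w w0 jJ v0 vu uR k1 k2.
  have u0 : 0 < u by lia.
  have k_lt0 : k < 0 by nia.
  have : - k * (v%:Z * w%:Z) <= K%:Z * (2%:Z * R%:Z) * (v%:Z * w%:Z).
    have j1 : 1 + j%:Z <= K%:Z * w%:Z by move: jJ; lia.
    have : (1 + j%:Z) * u <= K%:Z * w%:Z * u by rewrite ler_wpM2r // ltW.
    have : K%:Z * w%:Z * u <= K%:Z * w%:Z * (2%:Z * R%:Z * v%:Z) by rewrite ler_wpM2l.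
    by lia.
  rewrite ler_pM2r; last by rewrite mulr_gt0.
  by move=> ->; rewrite andbT oppr_gt0.
move=> j a b k l jJ cak cbl; have [ap akE] := cak; have [bp blE] := cbl.
have /andP[k0 kB] := cross_bound _ _ _ jJ cak; have /andP[l0 lB] := cross_bound _ _ _ jJ cbl.
have ga0 : 0 < pairing gam (cr a) := lt_le_trans (M1 n) (g_lower a ap).
have gb0 : 0 < pairing gam (cr b) := lt_le_trans (M1 n) (g_lower b bp).
have kl : k * pairing gam (cr b) = l * pairing gam (cr a).
  apply: (@near_crossings_proportional N%:Z _ _ _ _ j%:Z) => //; last 2 first.
  - by rewrite -PoszD addn1.
  - by rewrite -PoszD addn1.
  have := g_upper a ap; have := g_upper b bp; have := M1 n; rewrite -ME -PoszM -/G /N.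
  move: (pairing _ _) (pairing _ _) ga0 gb0 (M ^ n)%N => u v u0 v0 w w0 vG uG.
  have : u * v <= G%:Z * G%:Z by apply: ler_pM => //; exact: ltW.
  by rewrite PoszM; move: w0; nia.
(* the digit at place n collects the contributions of the leading powers *)
pose d m : int :=
  if @insub nat _ 'I_n m is Some i then k * c i b - l * c i a else k * h b - l * h a.
have d_ord (i : 'I_n) : d i = k * c i b - l * c i a by rewrite /d valK.
have d_n : d n = k * h b - l * h a by rewrite /d insubN // ltnn.
have dM m : `|d m| < M%:Z.
  have bound u v : 0 <= u -> u <= R%:Z -> 0 <= v -> v <= R%:Z -> `|k * u - l * v| < M%:Z.
    move=> u0 uR v0 vR; rewrite /M intS !PoszM.
    have : - k * u <= B%:Z * R%:Z by apply: ler_pM => //; exact: ltW.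
    have : - l * v <= B%:Z * R%:Z by apply: ler_pM => //; exact: ltW.
    have : 0 <= - k * u by rewrite mulr_ge0 // ltW.
    have : 0 <= - l * v by rewrite mulr_ge0 // ltW.
    by rewrite !mulNr; lia.
  rewrite /d; case: insub => [i|]; apply: bound; rewrite ?c0 ?hR //.
  - by apply: le_trans (ch i b bp) (hR b bp).
  - by apply: le_trans (ch i a ap) (hR a ap).
  - by apply: le_trans (h1 b bp).
  - by apply: le_trans (h1 a ap).
have dS : \sum_(i < n.+1) d i * M%:Z ^+ i = 0.
  rewrite big_ord_recr /= d_n; under eq_bigr do rewrite d_ord mulrBl -!mulrA.
  rewrite sumrB -!mulr_sumr.
  move/eqP: kl; rewrite !gamE -subr_eq0 => /eqP kl; rewrite -[RHS]kl; ring.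
have d0 := digits_eq0 dM dS.
have E : - k *: cr b = - l *: cr a.
  apply: pairing_injr => x; rewrite !pairingZr (fwE x) !pairing_suml !mulr_sumr.
  apply: eq_bigr => i _; rewrite !pairingZl; have := d0 i (ltnW (ltn_ord i)).
  by rewrite d_ord /c => /subr0_eq di; rewrite mulrCA [RHS]mulrCA !mulNr di.
have ab := proportional_coroots ap bp k0 E; split=> //.
move: kl; rewrite ab => /mulIf; apply.
by rewrite gt_eqF.
Qed.
End GenericDirection.

(** * Linkage *)

Section Linkage.
Variables (n p : nat) (D : based_root_datum n).
Hypothesis D_sc : simply_connected D.
Local Notation X := 'rV[int]_n.
Local Notation pos := (positive_root D).
Implicit Types (x y mu : X) (f : X -> int) (a : X).

Lemma affine_dot_rho a k x :
  affine_dot D p a k x + rho D = affine_reflection p D a k (x + rho D).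
Proof. by rewrite /affine_dot /affine_reflection addrAC. Qed.

Lemma dominance_le_pos_scale a (t : int) x :
  pos a -> dominance_le D x (x - t *: a) -> t <= 0.
Proof.
move=> ap [k]; rewrite addrAC subrr sub0r -scaleNr => E.
have aP := pos_root ap.
have : 0 <= root_form D (rho D) (- t *: a).
  rewrite E rformC rform_suml; apply: sumr_ge0 => i _; rewrite rformMnl mulrn_wge0 //.
  by rewrite rformC rform_root_sg ?base_root // rho_pairing.
rewrite rformZr pmulr_lge0 ?oppr_ge0 // rform_root_sg //.
exact: strictly_dominant_pos_gt0 (rho_strictly_dominant D_sc) ap.
Qed.

(** A chain uses finitely many hyperplanes, so their levels are bounded below. *)
Lemma up_linked_decreasing x y : up_linked D p x y -> exists K : nat,
  forall f, (forall a k, pos a -> - K%:Z <= k -> decreasing p D f a k) ->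
  f (y + rho D) <= f (x + rho D).
Proof.
elim=> [{}x|{}x {}y a k ap xle _ [K KP]]; first by exists 0%N.
exists (K + `|k|)%N => f fdec; apply: le_trans (KP f _) _.
  by move=> b l bp Kl; apply: fdec => //; lia.
rewrite affine_dot_rho; apply: fdec => //; first lia.
by rewrite -subr_le0; apply: dominance_le_pos_scale ap xle.
Qed.

Lemma up_linked_dominant_le f mu mu' :
  (forall b l, b \in root_set D -> 0 <= l -> decreasing p D f b l) ->
  dominant D mu -> dominant D mu' ->
  up_linked D p (mu - rho D) (mu' - rho D) -> f mu' <= f mu.
Proof.
move=> fdec mud mu'd /up_linked_decreasing[K KP].
have [gam [N [J [gam_dom N0 all_passed uniq_cross]]]] := generic_direction D_sc K.
have [|f' [f'dec le_f' f'E]] := @oriented_iter n p D gam N gam_dom N0 J f uniq_cross.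
  move=> b l bP; rewrite mul0r addr0 pmulr_lge0 //; exact: fdec.
apply: le_trans (le_f' mu') _; rewrite -(f'E mu mud).
have := KP f' _; rewrite !subrK; apply=> a k ap kK.
by apply: f'dec; [exact: pos_root|exact: all_passed].
Qed.

End Linkage.

Theorem theorem3p3p1 (n p : nat) (D : based_root_datum n)
    (p_prime : prime p)
    (D_sc : simply_connected D) (D_irr : irreducible_root_system D)
    (eta : group_ring 'rV[int]_n) (eta_inv : weyl_invariant D eta)
    (c : 'rV[int]_n -> int)
    (c_fin : finite_set (dominant D `&` [set mu | c mu != 0]))
    (eta_c : eta = \sum_(mu \in dominant D) orbit_sum D mu *~ c mu) :
  ((forall la, dominant D la ->
      good_filtration_character D (weyl_character D la * eta)) ->
   forall mu mu', dominant D mu -> dominant D mu' ->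
     dominance_le D mu mu' -> c mu' <= c mu)
  /\
  ((forall la, dominant D la ->
      good_filtration_character D
        (weyl_character D (rho D *+ p.-1 + la *+ p) * eta)) ->
   forall mu mu', dominant D mu -> dominant D mu' ->
     up_linked D p (mu - rho D) (mu' - rho D) -> c mu' <= c mu).
Proof.
have cE mu : dominant D mu -> c mu = coef mu eta.
  by move=> mud; rewrite eta_c coef_orbit_sums.
have subr_rho l : strictly_dominant D l -> dominant D (l - rho D).
  by move=> ls i; rewrite pairingBl rho_pairing // subr_ge0 -gtz0_ge1.
split=> good mu mu' mud mu'd; rewrite !cE //.
  have alt_ge0 l x : strictly_dominant D l -> strictly_dominant D x ->
      0 <= coef x (alternating_sum D (l *+ 1) * eta).
    move=> /subr_rho/good/(good_filtration_coef_ge0 D_sc) + xs => /(_ x xs).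
    by rewrite subrK.
  apply: (@descend_to_dominant _ _ D_sc (fun x => coef x eta)) => // i y yi.
  have iP := base_root D i.
  set k := pairing y _ in yi.
  (* y is the image of y - al i under the reflection at level k - 1, on whose lower side
     y - al i has pairing k - 2 *)
  have := @affine_reflection_le _ _ D_sc 1 eta isT alt_ge0 eta_inv
    (base D i) `|k - 1|%N (y - base D i) iP.
  rewrite pairingBl pairing_coroot // -/k mulr1.
  have -> : `|k - 1|%N%:Z = k - 1 by lia.
  have -> : k - 2 - (k - 1) = -1 by lia.
  by rewrite scaleN1r opprK subrK; apply; lia.
have p0 := prime_gt0 p_prime.
have alt_ge0 l x : strictly_dominant D l -> strictly_dominant D x ->
    0 <= coef x (alternating_sum D (l *+ p) * eta).
  move=> /subr_rho/good/(good_filtration_coef_ge0 D_sc) + xs => /(_ x xs).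
  congr (0 <= coef x (alternating_sum D _ * eta)).
  by rewrite mulrnBl addrAC -mulrSr prednK // addrC subrK.
apply: (@up_linked_dominant_le _ _ _ D_sc (fun x => coef x eta)) => // b l bP l0 x.
case: l l0 => // l _ xb; exact: affine_reflection_le.
Qed.
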